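(* (i) Let $B=B_{\mathcal B}(a,s)\neq B'=B_{\mathcal B}(a',s')$ be two discs in $\mathcal B^1$. Let $r=d_{\mathcal B}(B,B')$, $r_1=d_{\mathcal B}(B,B\vee B')$, $r_2=d_{\mathcal B}(B',B\vee B')$, so that $r=r_1+r_2$ and $s+r_1=s'+r_2$. Then a geodesic from $B$ to $B'$ in $(\mathcal B^1,d_{\mathcal B})$ is given by $$\gamma_{BB'}\colon[0,1]\to\mathcal B^1,\quad t\mapsto\begin{cases}B_{\mathcal B}(a,s+r t)& t\le r_1/r,\\ B_{\mathcal B}(a',s'+r(1-t))& t\ge r_1/r.\end{cases}$$ Moreover, for two distinct polydiscs $B=B_1\times\dots\times B_n$, $B'=B_1'\times\dots\times B_n'$ in $\mathcal B^n$, the product $\gamma_{BB'}:=\gamma_{B_1B_1'}\times\dots\times\gamma_{B_nB_n'}$ is a geodesic in $\mathcal B^n$ (with respect to $d_{\mathcal B}^p$). (ii) Let $B=B_{\mathcal H}(a,v)\ne B'=B_{\mathcal H}(a',v')$ be two discs in $\mathcal H^1$. Let $w=d_{\mathcal H}(B,B')$, $w_1=d_{\mathcal H}(B,B\vee B')$, $w_2=d_{\mathcal H}(B',B\vee B')$, so that $w=w_1+w_2$ and $v-w_1=v'-w_2$. Then a geodesic from $B$ to $B'$ in $(\mathcal H^1,d_{\mathcal H})$ is given by $$\gamma_{BB'}\colon[0,1]\to\mathcal H^1,\quad t\mapsto\begin{cases}B_{\mathcal H}(a,v-w t)& t\le w_1/w,\\ B_{\mathcal H}(a',v'-w(1-t))&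 t\ge w_1/w.\end{cases}$$ Moreover, for two distinct polydiscs $B=B_1\times\dots\times B_n$, $B'=B_1'\times\dots\times B_n'$ in $\mathcal H^n$, the product $\gamma_{BB'}:=\gamma_{B_1B_1'}\times\dots\times\gamma_{B_nB_n'}$ is a geodesic in $\mathcal H^n$ (with respect to $d_{\mathcal H}^p$). (iii) The polydisc spaces $(\mathcal B^n,d_{\mathcal B}^p)$ and $(\mathcal H^n,d_{\mathcal H}^p)$ are geodesic spaces for all integers $n\ge1$ and all $1\le p\le\infty$. They are uniquely geodesic spaces if $n=1$ or $1<p<\infty$.
   Context: $K$ is a field with a non-trivial valuation $\mathrm{val}\colon K\to\mathbb R\cup\{\infty\}$, complete with respect to the associated non-Archimedean absolute value $|a|=\exp(-\mathrm{val}(a))$ (base fixed). $\hat K$ is the completion of an algebraic closure of $K$, with the unique extensions of $\mathrm{val}$ and $|\cdot|$. For $a\in K^n$, $r\in\mathbb R_{\ge0}^n$, $v\in(\mathbb R\cup\{\infty\})^n$ put $B_{\mathcal B}(a,r)=\{z\in\hat K^n: |a_i-z_i|\le r_i\ \forall i\}$ and $B_{\mathcal H}(a,v)=\{z\in\hat K^n:\mathrm{val}(a_i-z_i)\ge v_i\ \forall i\}$. $\mathcal B^n$ is the set of all $B_{\mathcal B}(a,r)$ with $a\in K^n$, $r\in\mathbb R_{\ge 0}^n$, and $\mathcal H^n\subseteq\mathcal B^n$ is the subset of those with $r\in\mathbb R_{>0}^n$ (equivalently, of all $B_{\mathcal H}(a,v)$ with $v\in\mathbb R^n$). Join on $\mathcal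 B^1$: for $B=B_{\mathcal B}(a,r)$, $B'=B_{\mathcal B}(a',r')$, $B\vee B'=B\cup B'$ if one contains the other, and $B\vee B'=B_{\mathcal B}(a,|a-a'|)$ otherwise. Metrics for $n=1$: for $B=B_{\mathcal B}(a,r)=B_{\mathcal H}(a,v)$ and $B'=B_{\mathcal B}(a',r')=B_{\mathcal H}(a',v')$, if one contains the other then $d_{\mathcal B}(B,B')=|r-r'|$ (on $\mathcal B^1$) and $d_{\mathcal H}(B,B')=|v-v'|$ (on $\mathcal H^1$). Otherwise $d_\bullet(B,B')=d_\bullet(B,B\vee B')+d_\bullet(B\vee B',B')$. For products, $d_\bullet^p(B,B')=\big(\sum_i d_\bullet(B_i,B_i')^p\big)^{1/p}$ (maximum if $p=\infty$). A geodesic of speed $\lambda>0$ in a metric space $(X,d)$ is a map $\gamma\colon I\to X$ from a closed interval $I\subseteq\mathbb R$ with $d(\gamma(t),\gamma(t'))=\lambda|t-t'|$ for all $t,t'\in I$. $(X,d)$ is geodesic if any two points are connected by a geodesic, and uniquely geodesic if any two points are connected by exactly one geodesic of speed one (geodesics from $x$ to $y$ being regarded up to translation of the parameter interval). In the products in (i) and (ii), $\gamma_{B_iB_i'}$ is understood to be the constant path when $B_i=B_i'$. *)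

(* Defs.v *)
From HB Require Import structures.
From mathcomp Require Export all_boot all_order all_algebra.
From mathcomp Require Export all_classical all_reals all_analysis.

Set Implicit Arguments.
Unset Strict Implicit.
Unset Printing Implicit Defensive.
Import Order.TTheory GRing.Theory Num.Theory.

Local Open Scope classical_set_scope.
Local Open Scope ring_scope.

Section MetricSubspaces.
Variables (R : realType) (T : Type).
Implicit Types (X : set T) (d : T -> T -> R) (gamma : R -> T).

(* A metric space is given by a subset X of an ambient type and a function d
   of which only the values on X matter. *)
Definition is_metric X d :=
  [/\ forall x y, X x -> X y -> 0 <= d x y,
      forall x y, X x -> X y -> (d x y = 0 <-> x = y),
      forall x y, X x -> X y -> d x y = d y x
    & forall x y z, X x -> X y -> X z -> d x z <= d x y + d y z].

(* Only compact parameter intervals `[t0, t1] are needed, since all geodesics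
   considered connect two points; the values of gamma outside of the interval
   are irrelevant. *)
Definition geodesic_from_to X d (lam : R) (x y : T) (t0 t1 : R) gamma :=
  [/\ 0 < lam,
      t0 <= t1,
      forall t, t \in `[t0, t1] -> X (gamma t),
      forall t t', t \in `[t0, t1] -> t' \in `[t0, t1] ->
        d (gamma t) (gamma t') = lam * `|t - t'|
    & gamma t0 = x /\ gamma t1 = y].

Definition geodesic_space X d :=
  is_metric X d /\
  forall x y, X x -> X y ->
    exists lam t0 t1 gamma, geodesic_from_to X d lam x y t0 t1 gamma.

Definition same_up_to_translation (t0 t1 : R) gamma (u0 u1 : R) gamma' :=
  exists c, [/\ u0 = t0 + c, u1 = t1 + c &
    forall t, t \in `[t0, t1] -> gamma' (t + c) = gamma t].

Definition uniquely_geodesic_space X d :=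
  is_metric X d /\
  forall x y, X x -> X y ->
    (exists t0 t1 gamma, geodesic_from_to X d 1 x y t0 t1 gamma) /\
    (forall t0 t1 gamma u0 u1 gamma',
       geodesic_from_to X d 1 x y t0 t1 gamma ->
       geodesic_from_to X d 1 x y u0 u1 gamma' ->
       same_up_to_translation t0 t1 gamma u0 u1 gamma').

End MetricSubspaces.

Section Valuations.
Variable R : realType.

Definition is_valuation (F : fieldType) (v : F -> \bar R) :=
  [/\ forall x, v x != -oo%E,
      forall x, v x = +oo%E <-> x = 0,
      forall x y, v (x * y) = (v x + v y)%E
    & forall x y, (Order.min (v x) (v y) <= v (x + y)%R)%E].

Definition nontrivial_valuation (F : fieldType) (v : F -> \bar R) :=
  exists2 x, x != 0 & v x != 0%E.

(* |x| = b ^ (- v x), where b > 1 is the fixed base; |x| = 0 if v x = +oo. *)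
Definition absv (b : R) (F : fieldType) (v : F -> \bar R) (x : F) : R :=
  if v x is r%:E then b `^ (- r) else 0.

Definition complete_valued (b : R) (F : fieldType) (v : F -> \bar R) :=
  forall u : nat -> F,
    (forall e : R, 0 < e -> exists N : nat, forall m n : nat,
       (N <= m)%N -> (N <= n)%N -> absv b v (u m - u n) < e) ->
    exists l, forall e : R, 0 < e -> exists N : nat, forall n : nat,
       (N <= n)%N -> absv b v (u n - l) < e.

(* phi : K -> Khat exhibits (Khat, vhat) as the completion of an algebraic
   closure L of (K, v), with the extended valuation. *)
Definition completed_algebraic_closure (b : R) (K Khat : fieldType)
    (v : K -> \bar R) (vhat : Khat -> \bar R) (phi : {rmorphism K -> Khat}) :=
  [/\ is_valuation vhat,
      forall x, vhat (phi x) = v x,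
      complete_valued b vhat
    & exists (L : closedFieldType) (f : {rmorphism K -> L})
        (g : {rmorphism L -> Khat}),
        [/\ forall x, g (f x) = phi x,
            forall y : L, algebraicOver f y
          & forall (z : Khat) (e : R), 0 < e ->
              exists y : L, absv b vhat (z - g y) < e]].

End Valuations.

Section Discs.
Variables (R : realType) (b : R) (K Khat : fieldType).
Variables (vhat : Khat -> \bar R) (phi : {rmorphism K -> Khat}).

Definition discB (a : K) (r : R) : set Khat :=
  [set z | absv b vhat (phi a - z) <= r].

Definition discH (a : K) (v : \bar R) : set Khat :=
  [set z | (v <= vhat (phi a - z)%R)%E].

(* Discs are identified with the subsets of Khat they define. *)
Definition discsB : set (set Khat) :=
  [set B | exists a r, 0 <= r /\ B = discB a r].

Definition discsH : set (set Khat) :=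
  [set B | exists a r, 0 < r /\ B = discB a r].

(* A disc determines its radius, since |Khat| is dense in the nonnegative
   reals; its center in K is only determined up to the radius. *)
Definition radiusB (B : set Khat) : R :=
  xget 0 [set r | 0 <= r /\ exists a, B = discB a r].

Definition radiusH (B : set Khat) : R :=
  xget 0 [set v : R | exists a, B = discH a v%:E].

Definition centerB (B : set Khat) : K :=
  xget 0 [set a | exists r, 0 <= r /\ B = discB a r].

Definition nested (B B' : set Khat) := B `<=` B' \/ B' `<=` B.

Definition joinB (B B' : set Khat) : set Khat :=
  if `[< nested B B' >] then B `|` B'
  else discB (centerB B) (absv b vhat (phi (centerB B - centerB B'))).

Definition distB (B B' : set Khat) : R :=
  if `[< nested B B' >] then `|radiusB B - radiusB B'|
  else `|radiusB B - radiusB (joinB B B')|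
       + `|radiusB (joinB B B') - radiusB B'|.

Definition distH (B B' : set Khat) : R :=
  if `[< nested B B' >] then `|radiusH B - radiusH B'|
  else `|radiusH B - radiusH (joinB B B')|
       + `|radiusH (joinB B B') - radiusH B'|.

Definition gammaB (a : K) (s : R) (a' : K) (s' : R) (t : R) : set Khat :=
  let B := discB a s in
  let B' := discB a' s' in
  let r := distB B B' in
  let r1 := distB B (joinB B B') in
  if `[< B = B' >] then B
  else if t <= r1 / r then discB a (s + r * t)
  else discB a' (s' + r * (1 - t)).

Definition gammaH (a : K) (v : R) (a' : K) (v' : R) (t : R) : set Khat :=
  let B := discH a v%:E in
  let B' := discH a' v'%:E in
  let w := distH B B' in
  let w1 := distH B (joinB B B') in
  if `[< B = B' >] then B
  else if t <= w1 / w then discH a (v - w * t)%:E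
  else discH a' (v' - w * (1 - t))%:E.

End Discs.

Section Polydiscs.
Variables (R : realType) (b : R) (K Khat : fieldType).
Variables (vhat : Khat -> \bar R) (phi : {rmorphism K -> Khat}).

Definition prod_set n (B : 'I_n -> set Khat) : set 'rV[Khat]_n :=
  [set z | forall i, B i (z 0 i)].

(* The i-th factor of a nonempty product. *)
Definition factor n (B : set 'rV[Khat]_n) (i : 'I_n) : set Khat :=
  [set z 0 i | z in B].

Definition polydiscB n (a : 'rV[K]_n) (r : 'rV[R]_n) : set 'rV[Khat]_n :=
  prod_set (fun i => discB b vhat phi (a 0 i) (r 0 i)).

Definition polydiscH n (a : 'rV[K]_n) (v : 'rV[\bar R]_n) : set 'rV[Khat]_n :=
  prod_set (fun i => discH vhat phi (a 0 i) (v 0 i)).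

Definition polydiscsB n : set (set 'rV[Khat]_n) :=
  [set B | exists (a : 'rV[K]_n) (r : 'rV[R]_n),
             (forall i, 0 <= r 0 i) /\ B = polydiscB a r].

Definition polydiscsH n : set (set 'rV[Khat]_n) :=
  [set B | exists (a : 'rV[K]_n) (r : 'rV[R]_n),
             (forall i, 0 < r 0 i) /\ B = polydiscB a r].

(* Meant for 1 <= p <= +oo only. *)
Definition lp_dist (d : set Khat -> set Khat -> R) (p : \bar R) n
    (B B' : set 'rV[Khat]_n) : R :=
  match p with
  | q%:E => (\sum_(i < n) d (factor B i) (factor B' i) `^ q) `^ q^-1
  | _ => \big[Num.max/0]_(i < n) d (factor B i) (factor B' i)
  end.

Definition distBp := lp_dist (distB b vhat phi).
Definition distHp := lp_dist (distH b vhat phi).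

End Polydiscs.

(* Main.v *)
(** Discs ordered by inclusion form a tree whose branches merge upwards. If [ht]
    is the radius, or minus the logarithmic radius, and [top x y] the height of
    the join, then both metrics have the form
    [d x y = 2 * top x y - ht x - ht y]. The triangle inequality follows from
    the ultrametric inequality for [top], going up from [x] to the join and down
    to [y] is a geodesic, and a point [z] with [d x z + d z y = d x y] lies on
    one of the two branches, hence is determined by [d x z].
    In a product, moving in each factor proportionally to time is a geodesic
    because the l^p norm is homogeneous. If [1 < p < +oo], equality in
    Minkowski's inequality forces a point between two polydiscs to have
    proportional distances in each factor, so that uniqueness reduces to the
    factors. That a disc determines its radius uses the density of the value
    group of [Khat], obtained from roots of an element of nonzero valuation. *)

Require Import Defs.
From mathcomp Require Import ring lra.

Set Implicit Arguments.
Unset Strict Implicit.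
Unset Printing Implicit Defensive.
Import Order.TTheory GRing.Theory Num.Theory.
Local Open Scope classical_set_scope.
Local Open Scope ring_scope.

(** * Geodesics in trees *)

Section Geodesics.
Variables (R : realType) (T : Type).
Implicit Types (X : set T) (d : T -> T -> R) (gamma : R -> T).

Lemma geodesic_from_to_eq X d lam x y t0 t1 gamma gamma' :
    {in `[t0, t1], gamma =1 gamma'} ->
  geodesic_from_to X d lam x y t0 t1 gamma ->
  geodesic_from_to X d lam x y t0 t1 gamma'.
Proof.
move=> E [lam0 le01 Xg dg [g0 g1]].
have I0 : t0 \in `[t0, t1] by rewrite in_itv /= lexx le01.
have I1 : t1 \in `[t0, t1] by rewrite in_itv /= lexx le01.
split=> //; last by rewrite -!E.
  by move=> t It; rewrite -E //; apply: Xg.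
by move=> t t' It It'; rewrite -!E //; apply: dg.
Qed.

Lemma geodesic_unit_speed X d lam x y t0 t1 gamma :
    geodesic_from_to X d lam x y t0 t1 gamma ->
  geodesic_from_to X d 1 x y (lam * t0) (lam * t1) (fun t => gamma (t / lam)).
Proof.
move=> [lam0 le01 Xg dg [g0 g1]].
have lamN0 : lam != 0 by rewrite gt_eqF.
have I t : t \in `[lam * t0, lam * t1] -> t / lam \in `[t0, t1].
  by rewrite !in_itv /= ler_pdivlMr// ler_pdivrMr// ![_ * lam]mulrC.
split.
- exact: ltr01.
- by rewrite ler_pM2l.
- by move=> t /I; apply: Xg.
- move=> t t' /I It /I It'; rewrite dg// -mulrBl normrM mul1r.
  by rewrite normfV (gtr0_norm lam0) mulrC divfK.
- by rewrite ![lam * _]mulrC !mulfK.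
Qed.

(** Speeds are positive, so a point is joined to itself only over a one-point interval. *)
Lemma geodesic_refl X d lam x t0 : is_metric X d -> 0 < lam -> X x ->
  geodesic_from_to X d lam x x t0 t0 (fun=> x).
Proof.
move=> [_ d0 _ _] lam0 Xx; split=> // t t'.
rewrite !in_itv /= -!eq_le => /eqP <- /eqP <-.
by rewrite subrr normr0 mulr0; apply/d0.
Qed.

(** A condition free of paths that gives unique geodesics: on a unit speed geodesic from [x] to [y],
    the point at time [t] lies between the ends at distance [t - t0] from [x]. *)
Definition unique_between X d := forall x y z z', X x -> X y -> X z -> X z' ->
  d x z + d z y = d x y -> d x z' + d z' y = d x y -> d x z = d x z' -> z = z'.

Lemma geodesic_space_of_paths X d : is_metric X d ->
    (forall x y, X x -> X y -> x <> y ->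
      exists lam gamma, geodesic_from_to X d lam x y 0 1 gamma) ->
  geodesic_space X d.
Proof.
move=> dm H; split=> // x y Xx Xy; have [<-|xy] := pselect (x = y).
  by exists 1, 0, 0, (fun=> x); apply: geodesic_refl.
by have [lam [g Hg]] := H _ _ Xx Xy xy; exists lam, 0, 1, g.
Qed.

Lemma uniquely_geodesic_of_between X d : geodesic_space X d ->
  unique_between X d -> uniquely_geodesic_space X d.
Proof.
move=> [dm geo] ub; split=> // x y Xx Xy; split.
  have [lam [t0 [t1 [g Hg]]]] := geo _ _ Xx Xy.
  by exists (lam * t0), (lam * t1), (fun t => g (t / lam)); apply: geodesic_unit_speed.
move=> t0 t1 g u0 u1 g' [_ le01 Xg dg [g0 g1]] [_ le01' Xg' dg' [g0' g1']].
have I0 : t0 \in `[t0, t1] by rewrite in_itv /= lexx le01.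
have I1 : t1 \in `[t0, t1] by rewrite in_itv /= lexx le01.
have J0 : u0 \in `[u0, u1] by rewrite in_itv /= lexx le01'.
have J1 : u1 \in `[u0, u1] by rewrite in_itv /= lexx le01'.
have Et : d x y = t1 - t0.
  by rewrite -g0 -g1 dg// distrC ger0_norm ?subr_ge0// mul1r.
have Eu : d x y = u1 - u0.
  by rewrite -g0' -g1' dg'// distrC ger0_norm ?subr_ge0// mul1r.
(* Both intervals have length [d x y], so the shift matching the left ends also matches the right
   ends. *)
exists (u0 - t0); split; [lra|lra|] => t It.
have := It; rewrite in_itv /= => /andP[t0t tt1].
have Iu : t + (u0 - t0) \in `[u0, u1] by rewrite in_itv /=; apply/andP; split; lra.
have D1 : d x (g t) = t - t0 by rewrite -{1}g0 dg// distrC ger0_norm ?mul1r; lra.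
have D2 : d (g t) y = t1 - t by rewrite -{1}g1 dg// distrC ger0_norm ?mul1r; lra.
have D1' : d x (g' (t + (u0 - t0))) = t - t0.
  by rewrite -{1}g0' dg'// distrC ger0_norm ?mul1r; lra.
have D2' : d (g' (t + (u0 - t0))) y = t1 - t.
  by rewrite -{1}g1' dg'// distrC ger0_norm ?mul1r; lra.
apply: (ub x y) => //; [exact: Xg'|exact: Xg| | |]; lra.
Qed.

End Geodesics.

(* For discs ordered by inclusion: [up x h] is the disc of height [h]
   containing [x], and [top x y] is the height of the join of [x] and [y]. *)
Record merging_tree (R : realType) (T : Type) (X : set T)
    (ht : T -> R) (up : T -> R -> T) (top : T -> T -> R) : Prop := MergingTree {
  treeX_up : forall x h, X x -> ht x <= h -> X (up x h);
  tree_ht_up : forall x h, X x -> ht x <= h -> ht (up x h) = h;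
  tree_up_ht : forall x, X x -> up x (ht x) = x;
  tree_up_up : forall x h k, X x -> ht x <= h -> h <= k ->
    up (up x h) k = up x k;
  tree_ht_top : forall x y, X x -> X y -> ht x <= top x y;
  tree_topC : forall x y, X x -> X y -> top x y = top y x;
  tree_topP : forall x y h, X x -> X y -> ht x <= h -> ht y <= h ->
    (up x h = up y h <-> top x y <= h)
}.

(** * The metric of a merging tree *)

Section Tree.
Variables (R : realType) (T : Type) (X : set T).
Variables (ht : T -> R) (up : T -> R -> T) (top : T -> T -> R).
Variable d : T -> T -> R.
Hypothesis tree : merging_tree X ht up top.
Hypothesis dE : forall x y, X x -> X y -> d x y = 2 * top x y - ht x - ht y.

Lemma tree_ht_topr x y : X x -> X y -> ht y <= top x y.
Proof. by move=> Xx Xy; rewrite (tree_topC tree)//; exact: (tree_ht_top tree). Qed.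

Lemma tree_up_top x y : X x -> X y -> up x (top x y) = up y (top x y).
Proof.
move=> Xx Xy; apply/(tree_topP tree) => //; first exact: (tree_ht_top tree).
exact: tree_ht_topr.
Qed.

(** At the height of the maximum, the branch of [y] has merged with those of [x] and of [z], so
    these two have merged as well. *)
Lemma tree_top_ultra x y z : X x -> X y -> X z ->
  top x z <= Num.max (top x y) (top y z).
Proof.
move=> Xx Xy Xz; set h := Num.max _ _.
have h1 : top x y <= h by rewrite le_max lexx.
have h2 : top y z <= h by rewrite le_max lexx orbT.
have hx : ht x <= h := le_trans (tree_ht_top tree Xx Xy) h1.
have hy : ht y <= h := le_trans (tree_ht_topr Xx Xy) h1.
have hz : ht z <= h := le_trans (tree_ht_topr Xy Xz) h2.
apply/(tree_topP tree) => //; transitivity (up y h).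
  exact/(tree_topP tree).
exact/(tree_topP tree).
Qed.

Lemma tree_top_up x h : X x -> ht x <= h -> top x (up x h) = h.
Proof.
move=> Xx xh; have Xu := treeX_up tree Xx xh; have hu := tree_ht_up tree Xx xh.
apply/le_anti/andP; split; last by rewrite -{1}hu; exact: tree_ht_topr.
by apply/(tree_topP tree); rewrite ?hu// (tree_up_up tree).
Qed.

Lemma tree_dist_up x h : X x -> ht x <= h -> d x (up x h) = h - ht x.
Proof.
move=> Xx xh; rewrite dE ?tree_top_up ?(tree_ht_up tree)//; first lra.
exact: (treeX_up tree).
Qed.

Lemma tree_distC x y : X x -> X y -> d x y = d y x.
Proof. by move=> Xx Xy; rewrite !dE// (tree_topC tree)//; ring. Qed.

Lemma tree_metric : is_metric X d.
Proof.
split.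
- move=> x y Xx Xy; rewrite dE//.
  by have := tree_ht_top tree Xx Xy; have := tree_ht_topr Xx Xy; lra.
- move=> x y Xx Xy; split=> [|<-].
    rewrite dE// => E; have h1 := tree_ht_top tree Xx Xy.
    have h2 := tree_ht_topr Xx Xy.
    have [ex ey] : top x y = ht x /\ top x y = ht y by split; lra.
    by rewrite -(tree_up_ht tree Xx) -(tree_up_ht tree Xy) -ex -ey tree_up_top.
  by rewrite -{2}(tree_up_ht tree Xx) tree_dist_up// subrr.
- exact: tree_distC.
(* The claim amounts to [top x z + ht y <= top x y + top y z]. By the ultrametric inequality one
   summant on the right bounds [top x z], and the other one is at least [ht y]. *)
- move=> x y z Xx Xy Xz; rewrite !dE//.
  have := tree_ht_top tree Xy Xz; have := tree_ht_topr Xx Xy.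
  by have := tree_top_ultra Xx Xy Xz; rewrite le_max => /orP[]; lra.
Qed.

Lemma tree_unique_between : unique_between X d.
Proof.
(* A point between [x] and [y] lies above [x] or above [y], below the merging
   point of the two branches. *)
have key x y z : X x -> X y -> X z -> d x z + d z y = d x y ->
    z = if d x z <= top x y - ht x then up x (ht x + d x z)
        else up y (2 * top x y - ht x - d x z).
  move=> Xx Xy Xz; rewrite !dE// => E.
  have U := tree_top_ultra Xx Xz Xy.
  have l1 := tree_ht_topr Xx Xz; have l2 := tree_ht_top tree Xz Xy.
  have l3 := tree_ht_top tree Xx Xy; have l4 := tree_ht_topr Xx Xy.
  have l5 := tree_ht_top tree Xx Xz; have l6 := tree_ht_topr Xz Xy.
  (* The hypothesis reads [top x z + top z y = top x y + ht z]. One of the two terms on the left is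
     at least [top x y] and the other at least [ht z], so both bounds are equalities. *)
  have [[e1 e2]|[e1 e2]] : (top x z = ht z /\ top z y = top x y) \/
      (top z y = ht z /\ top x z = top x y).
    by move: U; rewrite le_max => /orP[] U; [right|left]; split; lra.
  - rewrite e1; have -> : 2 * ht z - ht x - ht z <= top x y - ht x by lra.
    have -> : ht x + (2 * ht z - ht x - ht z) = ht z by ring.
    by rewrite -{1}(tree_up_ht tree Xz) -e1 tree_up_top.
  - have zy : z = up y (ht z).
      by rewrite -{1}(tree_up_ht tree Xz) -e1 tree_up_top.
    rewrite e2; case: ifP => [le|_]; last first.
      by rewrite {1}zy; congr up; ring.
    (* A point on the branch of [y] that passes the test for the branch of [x] is the join, where
       both formulas agree. *)
    have hz : ht z = top x y by lra.
    by rewrite {1}zy hz -tree_up_top//; congr up; ring.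
move=> x y z z' Xx Xy Xz Xz' E E' Ed.
by rewrite (key _ _ _ Xx Xy Xz E) {1}Ed Ed -(key _ _ _ Xx Xy Xz' E').
Qed.

(** The test on [t] and the separate constant case copy [gammaB] and [gammaH], to make the
    comparison with them an unfolding. *)
Definition tree_path x y t :=
  let J := up x (top x y) in
  if `[< x = y >] then x
  else if t <= d x J / d x y then up x (ht x + d x y * t)
  else up y (ht y + d x y * (1 - t)).

Lemma tree_dist_split x y : X x -> X y ->
  let J := up x (top x y) in
  d x y = d x J + d y J /\ ht x + d x J = ht y + d y J.
Proof.
move=> Xx Xy J; have h1 := tree_ht_top tree Xx Xy; have h2 := tree_ht_topr Xx Xy.
have -> : d y J = top x y - ht y by rewrite /J tree_up_top// tree_dist_up.
by rewrite /J tree_dist_up// dE//; split; ring.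
Qed.

Lemma tree_dist_gt0 x y : X x -> X y -> x <> y -> 0 < d x y.
Proof.
move=> Xx Xy xy; have [d0 d0P _ _] := tree_metric.
rewrite lt_neqAle d0// andbT eq_sym; apply/eqP => E.
by apply: xy; apply/d0P.
Qed.

Lemma tree_path_left x y t : x <> y ->
    t <= d x (up x (top x y)) / d x y ->
  tree_path x y t = up x (ht x + d x y * t).
Proof. by move=> /asboolPn/negbTE xy tle; rewrite /tree_path xy tle. Qed.

(** At the breakpoint the definition takes the first branch, but there both formulas give the
    join. *)
Lemma tree_path_right x y t : X x -> X y -> x <> y ->
    d x (up x (top x y)) / d x y <= t ->
  tree_path x y t = up y (ht y + d x y * (1 - t)).
Proof.
move=> Xx Xy xy; have d0 := tree_dist_gt0 Xx Xy xy.
rewrite le_eqVlt => /orP[/eqP tE|lt_t]; last first.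
  by move: xy => /asboolPn/negbTE xy; rewrite /tree_path xy leNgt lt_t.
rewrite tree_path_left -?tE// mulrBr mulr1 mulrC divfK ?gt_eqF//.
rewrite tree_dist_up//; last exact: (tree_ht_top tree).
have -> : ht x + (top x y - ht x) = top x y by ring.
by rewrite tree_up_top// dE//; congr up; ring.
Qed.

(** Besides the formula, this records that neither branch is followed beyond the join, as the
    computation of distances requires. *)
Lemma tree_path_up x y t : X x -> X y -> x <> y -> t \in `[0, 1] ->
  let r := d x y in
  (ht x + r * t <= top x y /\ tree_path x y t = up x (ht x + r * t)) \/
  (ht y + r * (1 - t) <= top x y /\
    tree_path x y t = up y (ht y + r * (1 - t))).
Proof.
move=> Xx Xy xy It r; have d0 := tree_dist_gt0 Xx Xy xy.
have h1 := tree_ht_top tree Xx Xy.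
have [tl|tl] := leP t (d x (up x (top x y)) / d x y); [left|right].
  rewrite tree_path_left//; move: tl; rewrite ler_pdivlMr// tree_dist_up// /r.
  by split=> //; lra.
rewrite tree_path_right//; last exact: ltW.
move: tl; rewrite ltr_pdivrMr// tree_dist_up//.
by split=> //; move: tl; rewrite /r dE//; lra.
Qed.

Lemma tree_top_same x h k : X x -> ht x <= h -> h <= k ->
  top (up x h) (up x k) = k.
Proof.
move=> Xx xh hk; rewrite -(tree_up_up tree Xx xh hk).
by rewrite tree_top_up ?(tree_ht_up tree)//; apply: (treeX_up tree).
Qed.

(** Climbing towards the join does not move it: if the two new points merge at some height, then [x]
    and [y] have merged there too. *)
Lemma tree_top_branches x y h k : X x -> X y -> ht x <= h -> h <= top x y ->
  ht y <= k -> k <= top x y -> top (up x h) (up y k) = top x y.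
Proof.
move=> Xx Xy xh hm yk km.
have Xu := treeX_up tree Xx xh; have Xv := treeX_up tree Xy yk.
have hu := tree_ht_up tree Xx xh; have hv := tree_ht_up tree Xy yk.
apply/le_anti/andP; split.
  by apply/(tree_topP tree); rewrite ?hu ?hv// !(tree_up_up tree)// tree_up_top.
have := tree_up_top Xu Xv; have := tree_ht_top tree Xu Xv.
have := tree_ht_topr Xu Xv; rewrite hu hv => kk kh.
rewrite !(tree_up_up tree)// => /(tree_topP tree); apply=> //.
  exact: le_trans xh kh.
exact: le_trans yk kk.
Qed.

Lemma tree_path_in x y t : X x -> X y -> t \in `[0, 1] -> X (tree_path x y t).
Proof.
move=> Xx Xy It; have [xy|xy] := pselect (x = y).
  by move: (xy) => /asboolP xyb; rewrite /tree_path xyb.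
have d0 := tree_dist_gt0 Xx Xy xy.
have := It; rewrite in_itv /= => /andP[t0 t1].
have [[_ ->]|[_ ->]] := tree_path_up Xx Xy xy It; apply: (treeX_up tree) => //.
  by rewrite lerDl mulr_ge0// ltW.
by rewrite lerDl mulr_ge0 ?subr_ge0// ltW.
Qed.

(** Two points on one branch are as far apart as their heights; two points on different branches
    still have their join at height [top x y]. *)
Lemma tree_path_dist x y t t' : X x -> X y -> t \in `[0, 1] -> t' \in `[0, 1] ->
  d (tree_path x y t) (tree_path x y t') = d x y * `|t - t'|.
Proof.
move=> Xx Xy; have [d_ge0 d0P _ _] := tree_metric.
have [xy|xy] := pselect (x = y).
  move: (xy) => /asboolP xyb _ _; rewrite /tree_path xyb -xy.
  by have -> : d x x = 0; [exact/d0P|rewrite mul0r].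
have d0 := tree_dist_gt0 Xx Xy xy.
wlog tt' : t t' / t <= t' => [H It It'|].
  case: (leP t t') => [/H|/ltW/H]; first exact.
  by rewrite distrC tree_distC; [exact|exact: tree_path_in..].
move=> It It'; rewrite distrC ger0_norm ?subr_ge0//.
move: (It) (It'); rewrite !in_itv /= => /andP[t0 t1] /andP[t0' t1'].
have r0 := ltW d0.
have rt : 0 <= d x y * t by rewrite mulr_ge0.
have rt' : 0 <= d x y * (1 - t') by rewrite mulr_ge0 ?subr_ge0.
have rtt : d x y * t <= d x y * t' by rewrite ler_pM2l.
have [[a ->]|[a ->]] := tree_path_up Xx Xy xy It;
  have [[a' ->]|[a' ->]] := tree_path_up Xx Xy xy It'.
- rewrite dE ?(tree_ht_up tree) ?tree_top_same //; try apply: (treeX_up tree) => //; try lra.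
- rewrite dE ?(tree_ht_up tree) ?tree_top_branches //; try apply: (treeX_up tree) => //; try lra.
  by rewrite mulrBr (dE Xx Xy); lra.
- (* both points are then the merging point *)
  have E : d x y = 2 * top x y - ht x - ht y := dE Xx Xy.
  have e1 : ht y + d x y * (1 - t) = top x y by lra.
  have e2 : ht x + d x y * t' = top x y by lra.
  rewrite e1 e2 -tree_up_top//; have -> : d x y * (t' - t) = 0 by lra.
  by apply/d0P => //; apply: (treeX_up tree) => //; apply: (tree_ht_top tree).
- rewrite tree_distC; try (apply: (treeX_up tree) => //; lra).
  rewrite dE ?(tree_ht_up tree) ?tree_top_same //; try apply: (treeX_up tree) => //; try lra.
Qed.

Lemma tree_path0 x y : X x -> X y -> tree_path x y 0 = x.
Proof.
move=> Xx Xy; have [xy|xy] := pselect (x = y).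
  by move: (xy) => /asboolP xyb; rewrite /tree_path xyb.
rewrite tree_path_left// ?mulr0 ?addr0 ?(tree_up_ht tree)//.
have [d_ge0 _ _ _] := tree_metric.
by rewrite divr_ge0// d_ge0//; apply: (treeX_up tree) => //; apply: (tree_ht_top tree).
Qed.

Lemma tree_path1 x y : X x -> X y -> tree_path x y 1 = y.
Proof.
move=> Xx Xy; have [xy|xy] := pselect (x = y).
  by move: (xy) => /asboolP xyb; rewrite /tree_path xyb.
rewrite tree_path_right// ?subrr ?mulr0 ?addr0 ?(tree_up_ht tree)//.
rewrite ler_pdivrMr ?tree_dist_gt0// mul1r tree_dist_up ?(tree_ht_top tree)//.
by rewrite dE//; have := tree_ht_topr Xx Xy; lra.
Qed.

Lemma tree_path_geodesic x y : X x -> X y -> x <> y ->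
  geodesic_from_to X d (d x y) x y 0 1 (tree_path x y).
Proof.
move=> Xx Xy xy; split.
- exact: tree_dist_gt0.
- exact: ler01.
- by move=> t; apply: tree_path_in.
- by move=> t t'; apply: tree_path_dist.
- by rewrite tree_path0// tree_path1.
Qed.

End Tree.

(** * Finite l^p norms *)

Section LpNorm.
Variable R : realType.

(* With [l := ln x], multiply [exp (q l) / q + (1 - 1 / q) > exp l] by
   [exp (- l)] and bound both exponentials by their tangents at [0]. *)
Lemma bernoulli_powR_lt (q x : R) : 1 < q -> 0 <= x -> x != 1 ->
  1 + q * (x - 1) < x `^ q.
Proof.
move=> q1; rewrite le_eqVlt => /orP[/eqP <- _|x0 x1].
  by rewrite powR0 ?gt_eqF//; lra.
have lx : ln x != 0 by rewrite ln_eq0.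
have h1 : 1 + (q - 1) * ln x < expR ((q - 1) * ln x).
  by rewrite expR_gt1Dx// mulf_neq0// gt_eqF// subr_gt0.
have h2 : 1 - ln x < expR (- ln x) by rewrite expR_gt1Dx// oppr_eq0.
have -> : x `^ q = x * expR ((q - 1) * ln x).
  rewrite /powR gt_eqF// -{2}(lnK x0) -expRD; congr expR; ring.
move: h2; rewrite expRN lnK// => h2.
have h3 : x * (1 - ln x) < 1 by rewrite mulrC -ltr_pdivlMr// mul1r.
have h4 : x * (1 + (q - 1) * ln x) < x * expR ((q - 1) * ln x) by rewrite ltr_pM2l.
have h5 : (q - 1) * (x * (1 - ln x)) < q - 1 by rewrite gtr_pMr// subr_gt0.
lra.
Qed.

(** * Convexity of real powers *)

Section Convexity.
Variables (q l x y : R).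
Hypotheses (l0 : 0 < l) (l1 : l < 1) (x0 : 0 <= x) (y0 : 0 <= y).

(** Bernoulli's inequality at [x / c] and [y / c] puts the tangent of the power function at the mean
    [c] strictly below the graph. In the weighted sum of the two inequalities the linear terms
    cancel. *)
Lemma powR_strictly_convex : 1 < q -> x != y ->
  (l * x + (1 - l) * y) `^ q < l * x `^ q + (1 - l) * y `^ q.
Proof.
move=> q1 xy; set c := l * x + _.
have l1' : 0 < 1 - l by rewrite subr_gt0.
have c0 : 0 < c.
  have [x00|xN0] := eqVneq x 0.
    rewrite /c x00 mulr0 add0r mulr_gt0// lt_neqAle y0 andbT.
    by rewrite -x00.
  by rewrite /c ltr_pwDl// ?mulr_ge0// ?ltW// mulr_gt0// lt_neqAle eq_sym xN0.
have cq : 0 < c `^ q by exact: powR_gt0.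
have T z : 0 <= z -> z != c -> c `^ q * (1 + q * (z / c - 1)) < z `^ q.
  move=> z0 zc; have -> : z `^ q = c `^ q * (z / c) `^ q.
    by rewrite -powRM ?divr_ge0 ?(ltW c0)// mulrC divfK// gt_eqF.
  rewrite ltr_pM2l// bernoulli_powR_lt// ?divr_ge0 ?(ltW c0)//.
  by apply: contra_neq zc => /(congr1 ( *%R^~ c)); rewrite mul1r divfK ?gt_eqF.
have xc : x != c.
  apply: contra_neq xy => xc; apply: (mulfI (negbT (gt_eqF l1'))).
  by rewrite /c in xc; lra.
have yc : y != c.
  apply: contra_neq xy => yc; apply: (mulfI (negbT (gt_eqF l0))).
  by rewrite /c in yc; lra.
have := T _ x0 xc; rewrite -(ltr_pM2l l0) => hx.
have := T _ y0 yc; rewrite -(ltr_pM2l l1') => hy.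
apply: le_lt_trans (ltrD hx hy).
suff -> : l * (c `^ q * (1 + q * (x / c - 1))) +
    (1 - l) * (c `^ q * (1 + q * (y / c - 1))) = c `^ q by [].
have -> : l * (c `^ q * (1 + q * (x / c - 1))) +
    (1 - l) * (c `^ q * (1 + q * (y / c - 1))) =
    c `^ q * (1 + q * ((l * x + (1 - l) * y) / c - 1)) by ring.
by rewrite -/c divff ?gt_eqF// subrr mulr0 addr0 mulr1.
Qed.

Lemma powR_convex : 1 <= q ->
  (l * x + (1 - l) * y) `^ q <= l * x `^ q + (1 - l) * y `^ q.
Proof.
have ge0 : 0 <= l * x + (1 - l) * y.
  by rewrite addr_ge0// mulr_ge0// ?subr_ge0 ltW.
rewrite le_eqVlt => /orP[/eqP <-|q1]; first by rewrite !powRr1.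
have [->|xy] := eqVneq x y; last by apply: ltW; apply: powR_strictly_convex.
have E z : l * z + (1 - l) * z = z by ring.
by rewrite !E.
Qed.

End Convexity.

(** The cases are those of [lp_dist], so that [lp_distE] holds by computation. *)
Definition lp_norm (p : \bar R) n (a : 'I_n -> R) : R :=
  match p with
  | q%:E => (\sum_(i < n) a i `^ q) `^ q^-1
  | _ => \big[Num.max/0]_(i < n) a i
  end.

Section Norm.
Variables (p : \bar R) (n : nat).
Hypothesis p1 : (1 <= p)%E.
Implicit Types a b : 'I_n -> R.

Lemma lp_norm_ge0 a : 0 <= lp_norm p a.
Proof.
case: p p1 => [q||] //= _; first exact: powR_ge0.
exact: bigmax_ge_id.
Qed.

Lemma lp_norm_eq0 a : (forall i, 0 <= a i) ->
  lp_norm p a = 0 <-> forall i, a i = 0.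
Proof.
move=> a0; case: p p1 => [q||] //=; last 1 first.
- move=> _; split=> [E i|E].
    by apply/le_anti; rewrite a0 -E (le_bigmax _ a i).
  by apply/le_anti; rewrite bigmax_ge_id andbT; apply: bigmax_le => // i _; rewrite E.
rewrite lee_fin => q1; have q0 : 0 < q by apply: lt_le_trans q1.
split=> [/eqP|E].
  rewrite powR_eq0 => /andP[/eqP E _] i.
  have := psumr_eq0P (fun j _ => powR_ge0 (a j) q) E (erefl true : xpredT i).
  by move/eqP; rewrite powR_eq0 => /andP[/eqP].
rewrite big1 ?powR0 ?invr_eq0 ?gt_eqF// => i _.
by rewrite E powR0// gt_eqF.
Qed.

Lemma lp_normZ a c : 0 <= c -> (forall i, 0 <= a i) ->
  lp_norm p (fun i => c * a i) = c * lp_norm p a.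
Proof.
move=> c0 a0; case: p p1 => [q||] //=; last first.
  by move=> _; rewrite (big_morph ( *%R c) (fun x y => maxr_pMr x y c0) (mulr0 c)).
rewrite lee_fin => q1; have q0 : q != 0 by rewrite gt_eqF// (lt_le_trans _ q1).
under eq_bigr do rewrite powRM//.
rewrite -mulr_sumr powRM ?powR_ge0//; last first.
  by apply: sumr_ge0 => i _; exact: powR_ge0.
by rewrite -powRrM divff// powRr1.
Qed.

Lemma lp_norm_le a b : (forall i, 0 <= a i <= b i) ->
  lp_norm p a <= lp_norm p b.
Proof.
move=> ab; case: p p1 => [q| |] q1; last by [].
  move: q1; rewrite lee_fin => q1; have q0 : 0 <= q by apply: le_trans q1.
  apply: ge0_ler_powR; rewrite ?invr_ge0 ?nnegrE//.
  - by apply: sumr_ge0 => i _; exact: powR_ge0.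
  - by apply: sumr_ge0 => i _; exact: powR_ge0.
  apply: ler_sum => i _; have /andP[h1 h2] := ab i.
  by apply: ge0_ler_powR; rewrite ?nnegrE// (le_trans h1 h2).
by apply: le_bigmax2 => i _; have /andP[] := ab i.
Qed.

End Norm.

Lemma lp_norm1 (p : \bar R) (a : 'I_1 -> R) : (1 <= p)%E ->
  (forall i, 0 <= a i) -> lp_norm p a = a ord0.
Proof.
move=> p1 a0; case: p p1 => [q||] //=; last first.
  by move=> _; rewrite big_ord_recl big_ord0; apply/max_idPl.
rewrite lee_fin => q1; have q0 : q != 0 by rewrite gt_eqF// (lt_le_trans _ q1).
by rewrite big_ord_recl big_ord0 addr0 -powRrM divff// powRr1.
Qed.

Lemma lp_normK (q : R) n (a : 'I_n -> R) : 1 <= q ->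
  (lp_norm q%:E a) `^ q = \sum_(i < n) a i `^ q.
Proof.
move=> q1; have q0 : q != 0 by rewrite gt_eqF// (lt_le_trans _ q1).
by rewrite /= -powRrM mulVf// powRr1//; apply: sumr_ge0 => i _; exact: powR_ge0.
Qed.

(** * Minkowski's inequality and its equality case *)

Section Minkowski.
Variables (q A B : R) (n : nat) (a b : 'I_n -> R).
Hypotheses (q1 : 1 <= q) (a0 : forall i, 0 <= a i) (b0 : forall i, 0 <= b i).
Hypotheses (A_ge0 : 0 <= A) (AE : A `^ q = \sum_(i < n) a i `^ q).
Hypotheses (B_ge0 : 0 <= B) (BE : B `^ q = \sum_(i < n) b i `^ q).

Let qN0 : q != 0. Proof. by rewrite gt_eqF// (lt_le_trans _ q1). Qed.

Let powR_div x y : 0 <= x -> 0 < y -> (x / y) `^ q = x `^ q / y `^ q.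
Proof.
move=> x0 y0; have y0' := ltW y0.
apply: (mulIf (negbT (gt_eqF (powR_gt0 q y0)))).
rewrite divfK ?gt_eqF ?powR_gt0//.
by rewrite -powRM ?divr_ge0// divfK// gt_eqF.
Qed.

Let sum_powR_eq0 (f : 'I_n -> R) : \sum_(i < n) f i `^ q = 0 ->
  forall i, f i = 0.
Proof.
move=> E i; have /eqP := psumr_eq0P (fun j _ => powR_ge0 (f j) q) E (erefl true : xpredT i).
by rewrite powR_eq0 => /andP[/eqP].
Qed.

Section Positive.
Hypotheses (A_gt0 : 0 < A) (B_gt0 : 0 < B).
(** The weight that makes [(a + b) / (A + B)] a convex combination of [a / A] and [b / B], two
    vectors of norm 1. *)
Let l := A / (A + B).

Let l0 : 0 < l. Proof. exact: divr_gt0 (addr_gt0 _ _). Qed.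

Let l1 : l < 1.
Proof. by rewrite ltr_pdivrMr ?addr_gt0// mul1r ltrDl. Qed.

Let convex_comb i :
  (a i + b i) / (A + B) = l * (a i / A) + (1 - l) * (b i / B).
Proof. by rewrite /l; field; rewrite !gt_eqF// addr_gt0. Qed.

Let term_le i : ((a i + b i) / (A + B)) `^ q <=
  l * (a i / A) `^ q + (1 - l) * (b i / B) `^ q.
Proof.
by rewrite convex_comb; apply: powR_convex => //; apply: divr_ge0.
Qed.

Let sum_terms :
  \sum_(i < n) (l * (a i / A) `^ q + (1 - l) * (b i / B) `^ q) = 1.
Proof.
under eq_bigr do rewrite (powR_div (a0 _) A_gt0) (powR_div (b0 _) B_gt0).
rewrite big_split /= -!mulr_sumr -!mulr_suml -AE -BE.
by rewrite !divff ?gt_eqF ?powR_gt0//; ring.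
Qed.

Let sum_normalized : \sum_(i < n) ((a i + b i) / (A + B)) `^ q =
  (\sum_(i < n) (a i + b i) `^ q) / (A + B) `^ q.
Proof.
rewrite mulr_suml; apply: eq_bigr => i _.
by rewrite powR_div ?addr_ge0 ?addr_gt0.
Qed.

Lemma minkowski_sum_pos : \sum_(i < n) (a i + b i) `^ q <= (A + B) `^ q.
Proof.
have AB : 0 < (A + B) `^ q by apply: powR_gt0; apply: addr_gt0.
rewrite -[leRHS]mul1r -ler_pdivrMr// -sum_normalized -sum_terms.
by apply: ler_sum => i _; apply: term_le.
Qed.

(** Equality of the sums forces equality in the convexity inequality of every coordinate, and strict
    convexity then gives [a i / A = b i / B]. *)
Lemma minkowski_sum_pos_eq : 1 < q ->
  \sum_(i < n) (a i + b i) `^ q = (A + B) `^ q ->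
  forall i, (A + B) * a i = A * (a i + b i).
Proof.
move=> q_gt1 E i; have AB0 : 0 < A + B by apply: addr_gt0.
have := sum_normalized; rewrite E divff ?gt_eqF ?powR_gt0//.
rewrite -sum_terms => /esym/eqP; rewrite -subr_eq0 -sumrB => /eqP Z.
have {}Z : ((a i + b i) / (A + B)) `^ q =
   l * (a i / A) `^ q + (1 - l) * (b i / B) `^ q.
  apply/esym/eqP; rewrite -subr_eq0; apply/eqP.
  by apply: (psumr_eq0P _ Z) => // j _; rewrite subr_ge0.
have [ab|ab] := eqVneq (a i / A) (b i / B).
  have -> : b i = a i / A * B by rewrite ab divfK// gt_eqF.
  by field; rewrite gt_eqF.
have := powR_strictly_convex l0 l1 (divr_ge0 (a0 i) A_ge0)
  (divr_ge0 (b0 i) B_ge0) q_gt1 ab.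
by rewrite -convex_comb Z ltxx.
Qed.

End Positive.

Lemma minkowski_sum : \sum_(i < n) (a i + b i) `^ q <= (A + B) `^ q.
Proof.
move: A_ge0; rewrite le_eqVlt => /orP[/eqP A0|A0].
  have Ea : forall i, a i = 0 by apply: sum_powR_eq0; rewrite -AE -A0 powR0.
  by rewrite -A0 add0r BE; under eq_bigr do rewrite Ea add0r.
move: B_ge0; rewrite le_eqVlt => /orP[/eqP B0|B0].
  have Eb : forall i, b i = 0 by apply: sum_powR_eq0; rewrite -BE -B0 powR0.
  by rewrite -B0 addr0 AE; under eq_bigr do rewrite Eb addr0.
exact: minkowski_sum_pos.
Qed.

(** Proportionality is stated without quotients, so that it makes sense when [A] or [B] vanishes. *)
Lemma minkowski_sum_eq : 1 < q ->
  \sum_(i < n) (a i + b i) `^ q = (A + B) `^ q ->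
  forall i, (A + B) * a i = A * (a i + b i).
Proof.
move: A_ge0; rewrite le_eqVlt => /orP[/eqP A0|A0].
  have Ea : forall i, a i = 0 by apply: sum_powR_eq0; rewrite -AE -A0 powR0.
  by move=> _ _ i; rewrite Ea -A0 mul0r mulr0.
move: B_ge0; rewrite le_eqVlt => /orP[/eqP B0|B0].
  have Eb : forall i, b i = 0 by apply: sum_powR_eq0; rewrite -BE -B0 powR0.
  by move=> _ _ i; rewrite Eb -B0 !addr0.
exact: minkowski_sum_pos_eq.
Qed.

End Minkowski.

Lemma powR_le_inv (q x y : R) : 0 < q -> 0 <= x -> 0 <= y ->
  x `^ q <= y `^ q -> x <= y.
Proof.
move=> q0 x0 y0; rewrite leNgt => /negP h; rewrite leNgt; apply/negP => lt.
by apply: h; apply: gt0_ltr_powR; rewrite ?nnegrE.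
Qed.

Lemma lp_norm_triangle (p : \bar R) n (a b : 'I_n -> R) : (1 <= p)%E ->
    (forall i, 0 <= a i) -> (forall i, 0 <= b i) ->
  lp_norm p (fun i => a i + b i) <= lp_norm p a + lp_norm p b.
Proof.
move=> p1 a0 b0; have N c := lp_norm_ge0 (n := n) p1 c.
case: p p1 N => [q| |] p1 N; last by [].
- move: (p1); rewrite lee_fin => q1.
  apply: (powR_le_inv (lt_le_trans ltr01 q1)) (N _) (addr_ge0 (N _) (N _)) _.
  by rewrite lp_normK//; apply: minkowski_sum; rewrite ?lp_normK.
- apply: bigmax_le => [|i _]; first exact: addr_ge0 (N _) (N _).
  exact: lerD (le_bigmax _ a i) (le_bigmax _ b i).
Qed.

Lemma lp_norm_triangle_eq (q : R) n (a b : 'I_n -> R) : 1 < q ->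
    (forall i, 0 <= a i) -> (forall i, 0 <= b i) ->
  let A := lp_norm q%:E a in let B := lp_norm q%:E b in
  lp_norm q%:E (fun i => a i + b i) = A + B ->
  forall i, (A + B) * a i = A * (a i + b i).
Proof.
move=> q1 a0 b0 A B /(congr1 (fun x => x `^ q)).
have q1' := ltW q1; have q1E : (1 <= q%:E)%E by rewrite lee_fin.
rewrite lp_normK//; apply: minkowski_sum_eq => //.
- exact: lp_norm_ge0 q1E _.
- exact: lp_normK.
- exact: lp_norm_ge0 q1E _.
- exact: lp_normK.
Qed.

(** The differences of the [q]-th powers are nonnegative and sum to zero. For the maximum norm this
    fails. *)
Lemma lp_norm_inj (q : R) n (a b : 'I_n -> R) : 1 <= q ->
    (forall i, 0 <= a i <= b i) -> lp_norm q%:E a = lp_norm q%:E b ->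
  forall i, a i = b i.
Proof.
move=> q1 ab /(congr1 (@powR R ^~ q)) E.
have /esym/eqP := etrans (esym (lp_normK a q1)) (etrans E (lp_normK b q1)).
have q0 : 0 < q by apply: lt_le_trans q1.
have b0 i : 0 <= b i by have /andP[h /(le_trans h)] := ab i.
rewrite -subr_eq0 -sumrB => /eqP Z i.
have ab_pow j : 0 <= b j `^ q - a j `^ q.
  have /andP[h1 h2] := ab j; rewrite subr_ge0.
  by apply: ge0_ler_powR (ltW q0) _ _ _ _ h2; rewrite nnegrE.
have {}Z := psumr_eq0P (fun j _ => ab_pow j) Z (erefl true : xpredT i).
have /andP[h1] := ab i; rewrite le_eqVlt => /orP[/eqP //|lt].
have : a i `^ q < b i `^ q by apply: gt0_ltr_powR q0 _ _ _ _ lt; rewrite nnegrE.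
by rewrite -subr_gt0 Z ltxx.
Qed.

(** Meant for the factorwise distances [u] from [P] to [Q], [v] from [P] to [Z] and [w] from [Z] to
    [Q]. The norm of [v + w] is squeezed between that of [u] and the sum of those of [v] and [w], so
    monotonicity and Minkowski's inequality are both equalities. *)
Lemma lp_norm_triangle_eq_le (q : R) n (u v w : 'I_n -> R) : 1 < q ->
    (forall i, 0 <= v i) -> (forall i, 0 <= w i) ->
    (forall i, 0 <= u i <= v i + w i) ->
    lp_norm q%:E v + lp_norm q%:E w = lp_norm q%:E u ->
  (forall i, v i + w i = u i) /\
  (forall i, lp_norm q%:E u * v i = lp_norm q%:E v * u i).
Proof.
move=> q1 v0 w0 uvw E; have q1E : (1 <= q%:E)%E by rewrite lee_fin ltW.
have M1 := lp_norm_le q1E uvw; have M2 := lp_norm_triangle q1E v0 w0.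
have Eu : lp_norm q%:E u = lp_norm q%:E (fun j => v j + w j).
  apply: le_anti; apply/andP; split; first exact: M1.
  by move: M2; rewrite E; exact: id.
have H := lp_norm_inj (ltW q1) uvw Eu.
split=> i; first exact: esym (H i).
have := lp_norm_triangle_eq q1 v0 w0 (esym (etrans E Eu)) i.
by rewrite E H.
Qed.

End LpNorm.

(** * Products *)

Section Products.
Variables (R : realType) (F : fieldType) (X : set (set F)).
Variables (d : set F -> set F -> R) (p : \bar R) (n : nat).
Hypotheses (X_neq0 : forall B, X B -> B !=set0) (d_metric : is_metric X d).
Hypothesis (p1 : (1 <= p)%E).

Definition products : set (set 'rV[F]_n) :=
  [set P | exists2 B : 'I_n -> set F, (forall i, X (B i)) & P = prod_set B].

(** Extending a point of [B i] to the product takes a point in each other factor, hence nonempty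
    factors. *)
Lemma factor_prod_set (B : 'I_n -> set F) i : (forall j, X (B j)) ->
  factor (prod_set B) i = B i.
Proof.
move=> XB; have /choice[c cP] j : exists z, B j z by apply/X_neq0.
apply/seteqP; split=> [_ [z zB <-]|z Bz]; first exact: zB.
exists (\row_j if j == i then z else c j); last by rewrite mxE eqxx.
by move=> j; rewrite mxE; case: eqP => [->|].
Qed.

Lemma products_factor P i : products P -> X (factor P i).
Proof. by move=> [B XB ->]; rewrite factor_prod_set. Qed.

Lemma prod_set_factor P : products P -> prod_set (factor P) = P.
Proof.
move=> [B XB ->]; congr prod_set; apply/funext => i.
exact: factor_prod_set.
Qed.

Lemma lp_distE P Q :
  lp_dist d p P Q = lp_norm p (fun i : 'I_n => d (factor P i) (factor Q i)).
Proof. by []. Qed.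

Lemma lp_dist_prod_set (B C : 'I_n -> set F) :
    (forall i, X (B i)) -> (forall i, X (C i)) ->
  lp_dist d p (prod_set B) (prod_set C) = lp_norm p (fun i => d (B i) (C i)).
Proof.
move=> XB XC; rewrite lp_distE; congr lp_norm; apply/funext => i.
by rewrite !factor_prod_set.
Qed.

Let dist_ge0 P Q i : products P -> products Q ->
  0 <= d (factor P i) (factor Q i).
Proof.
by move=> hP hQ; have [d0 _ _ _] := d_metric; apply: d0; apply: products_factor.
Qed.

Lemma lp_dist_metric : is_metric products (lp_dist d p (n := n)).
Proof.
have [d0 d0P dC dT] := d_metric; split.
- by move=> P Q hP hQ; exact: lp_norm_ge0 p1 _.
- move=> P Q hP hQ.
  have E := lp_norm_eq0 p1 (fun i => dist_ge0 i hP hQ).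
  rewrite lp_distE; split=> [/E PQ|PQ].
    rewrite -(prod_set_factor hP) -(prod_set_factor hQ); congr prod_set.
    by apply/funext => i; apply/d0P => //; apply: products_factor.
  apply/E => i; apply/d0P; rewrite ?PQ//; exact: products_factor.
- move=> P Q hP hQ; rewrite !lp_distE; congr lp_norm; apply/funext => i.
  by apply: dC; apply: products_factor.
- move=> P Q S hP hQ hS; rewrite !lp_distE.
  have H := lp_norm_triangle p1 (fun i => dist_ge0 i hP hQ) (fun i => dist_ge0 i hQ hS).
  apply: le_trans H; apply: (lp_norm_le p1) => i; rewrite dist_ge0//=.
  by apply: dT; apply: products_factor.
Qed.

(** The paths in the factors are given by their distance formula and not as geodesics, because a
    factor with [B i = C i] has speed zero. *)
Lemma prod_geodesic (B C : 'I_n -> set F) (gamma : 'I_n -> R -> set F) :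
    (forall i, X (B i)) -> (forall i, X (C i)) -> prod_set B <> prod_set C ->
    (forall i t, t \in `[0, 1] -> X (gamma i t)) ->
    (forall i t t', t \in `[0, 1] -> t' \in `[0, 1] ->
      d (gamma i t) (gamma i t') = d (B i) (C i) * `|t - t'|) ->
    (forall i, gamma i 0 = B i) -> (forall i, gamma i 1 = C i) ->
  geodesic_from_to products (lp_dist d p (n := n))
    (lp_dist d p (prod_set B) (prod_set C)) (prod_set B) (prod_set C) 0 1
    (fun t => prod_set (gamma ^~ t)).
Proof.
move=> XB XC BC Xg dg g0 g1; have [ld0 ld0P _ _] := lp_dist_metric.
have hB : products (prod_set B) by exists B.
have hC : products (prod_set C) by exists C.
have [d0 _ _ _] := d_metric.
split.
- rewrite lt_neqAle ld0// andbT eq_sym; apply/eqP => E.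
  by apply: BC; apply/ld0P.
- exact: ler01.
- by move=> t It; exists (gamma ^~ t) => // i; apply: Xg.
- move=> t t' It It'; rewrite !lp_dist_prod_set//; try by move=> i; apply: Xg.
  rewrite mulrC -(lp_normZ p1) ?normr_ge0//; last by move=> i; apply: d0.
  by congr lp_norm; apply/funext => i; rewrite dg// mulrC.
- by split; congr prod_set; apply/funext => i.
Qed.

Lemma prod_unique_between : unique_between X d ->
  n = 1%N \/ (1 < p < +oo)%E -> unique_between products (lp_dist d p (n := n)).
Proof.
have [d0 _ _ dT] := d_metric.
move=> ub np P Q Z Z' hP hQ hZ hZ'; rewrite !lp_distE => E E' EZ.
rewrite -(prod_set_factor hZ) -(prod_set_factor hZ'); congr prod_set.
apply/funext => i; have Xf := products_factor i.
suff [h1 h2 h3] : [/\ d (factor P i) (factor Z i) + d (factor Z i) (factor Q i) =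
      d (factor P i) (factor Q i),
    d (factor P i) (factor Z' i) + d (factor Z' i) (factor Q i) =
      d (factor P i) (factor Q i)
    & d (factor P i) (factor Z i) = d (factor P i) (factor Z' i)].
  exact: (ub _ _ _ _ (Xf _ hP) (Xf _ hQ) (Xf _ hZ) (Xf _ hZ') h1 h2 h3).
have dnn S S' j : products S -> products S' -> 0 <= d (factor S j) (factor S' j).
  exact: dist_ge0.
case: np => [n1|/andP[p_gt1 p_lt]].
  have N1 (a : 'I_n -> R) : (forall j, 0 <= a j) -> lp_norm p a = a i.
    move: i a {Xf}; rewrite n1 => i a a0.
    by rewrite (lp_norm1 p1 a0); congr a; apply/val_inj; case: i => [[]].
  by split; [move: E|move: E'|move: EZ]; rewrite !N1// => j; exact: dnn.
case: p p_gt1 p_lt p1 E E' EZ => [q| |]; [|by []..].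
rewrite lte_fin => q1 _ q1E E E' EZ.
(* Equality in both the triangle inequality in each factor and in Minkowski's
   inequality makes the distances to [P] proportional to those of [P], [Q]. *)
have main S : products S ->
    lp_norm q%:E (fun i => d (factor P i) (factor S i)) +
    lp_norm q%:E (fun i => d (factor S i) (factor Q i)) =
    lp_norm q%:E (fun i => d (factor P i) (factor Q i)) ->
  (forall j, d (factor P j) (factor S j) + d (factor S j) (factor Q j) =
             d (factor P j) (factor Q j)) /\
  (forall j, lp_norm q%:E (fun i => d (factor P i) (factor Q i)) *
       d (factor P j) (factor S j) =
     lp_norm q%:E (fun i => d (factor P i) (factor S i)) *
       d (factor P j) (factor Q j)).
  move=> hS; apply: (lp_norm_triangle_eq_le q1) => j; [exact: dnn|exact: dnn|].
  apply/andP; split; first exact: dnn.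
  by apply: dT; apply: products_factor.
have [h1 h1'] := main _ hZ E; have [h2 h2'] := main _ hZ' E'.
split; [exact: h1|exact: h2|].
(* Proportionality says nothing if [P] and [Q] are at distance zero, but then every distance in the
   factors vanishes. *)
have [N0|N0] := eqVneq (lp_norm q%:E (fun i => d (factor P i) (factor Q i))) 0.
  have /(_ i) PQ := (lp_norm_eq0 q1E (fun j => dnn P Q j hP hQ)).1 N0.
  have zero S : products S -> d (factor P i) (factor S i) +
      d (factor S i) (factor Q i) = d (factor P i) (factor Q i) ->
      d (factor P i) (factor S i) = 0.
    move=> hS /eqP; rewrite PQ (paddr_eq0 (dnn _ _ _ hP hS) (dnn _ _ _ hS hQ)).
    by case/andP => /eqP.
  exact: etrans (zero _ hZ (h1 i)) (esym (zero _ hZ' (h2 i))).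
exact: mulfI N0 _ _ (etrans (h1' i) (etrans (congr1 ( *%R^~ _) EZ) (esym (h2' i)))).
Qed.

End Products.
Arguments products [F] X n.

(** * Valued fields *)

Section ValuedField.
Variables (R : realType) (b : R) (F : fieldType) (v : F -> \bar R).
Hypotheses (b_gt1 : 1 < b) (v_val : is_valuation v).

Let b_gt0 : 0 < b. Proof. exact: lt_trans b_gt1. Qed.

Lemma valuation_fin_num x : x != 0 -> exists r, v x = r%:E.
Proof.
have [vNy vy _ _] := v_val; move=> x0.
case E : (v x) => [r| |]; first by exists r.
- by move/vy : E => x00; rewrite x00 eqxx in x0.
- by move: (vNy x); rewrite E.
Qed.

Lemma valuation0 : v 0 = +oo%E.
Proof. by have [_ vy _ _] := v_val; apply/vy. Qed.

Lemma valuation1 : v 1 = 0%E.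
Proof.
have [_ _ vM _] := v_val; have := vM 1 1; rewrite mulr1.
have [r ->] := valuation_fin_num (oner_neq0 F).
by rewrite -EFinD => -[]/eqP; rewrite -subr_eq0 opprD addNKr oppr_eq0 => /eqP ->.
Qed.

Lemma valuationX x r n : v x = r%:E -> v (x ^+ n) = (r *+ n)%:E.
Proof.
have [_ _ vM _] := v_val => E; elim: n => [|n IH].
  by rewrite expr0 valuation1.
by rewrite exprS vM E IH -EFinD mulrS.
Qed.

Lemma valuationV x r : v x = r%:E -> v x^-1 = (- r)%:E.
Proof.
have [_ _ vM _] := v_val => E.
have x0 : x != 0 by apply/eqP => x0; move: E; rewrite x0 valuation0.
have [s Es] : exists s, v x^-1 = s%:E by apply: valuation_fin_num; rewrite invr_eq0.
have := vM x x^-1; rewrite divff// valuation1 E Es -EFinD => -[] rs.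
by congr EFin; lra.
Qed.

Lemma valuationXz x r (k : int) : v x = r%:E -> v (x ^ k) = (k%:~R * r)%:E.
Proof.
move=> E; case: k => n.
  by rewrite -exprnP (valuationX n E) mulr_natl.
rewrite NegzE -exprnN (valuationV (valuationX n.+1 E)).
by rewrite mulrNz mulNr mulr_natl.
Qed.

Lemma valuationN x : v (- x) = v x.
Proof.
have [_ _ vM _] := v_val; rewrite -mulN1r vM.
suff -> : v (-1) = 0%E by rewrite add0e.
have [r E] : exists r, v (-1) = r%:E.
  by apply: valuation_fin_num; rewrite oppr_eq0 oner_neq0.
have := vM (-1) (-1); rewrite mulrNN mulr1 valuation1 E -EFinD => -[] rr.
by congr EFin; lra.
Qed.

Local Notation abs := (absv b v).

Lemma absv_ge0 x : 0 <= abs x.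
Proof. by rewrite /absv; case: (v x) => [r| |]//; exact: powR_ge0. Qed.

Lemma absv_fin x r : v x = r%:E -> abs x = b `^ (- r).
Proof. by rewrite /absv => ->. Qed.

Lemma absv0 : abs 0 = 0.
Proof. by rewrite /absv valuation0. Qed.

Lemma absvN x : abs (- x) = abs x.
Proof. by rewrite /absv valuationN. Qed.

Lemma absvC x y : abs (x - y) = abs (y - x).
Proof. by rewrite -absvN opprB. Qed.

Lemma absv_leP (r : R) x : (abs x <= b `^ (- r)) = (r%:E <= v x)%E.
Proof.
have [vNy _ _ _] := v_val; have := vNy x; rewrite /absv.
case: (v x) => [s| |]// _; last by rewrite powR_ge0 leey.
by rewrite lee_fin -[in RHS]lerN2 /powR gt_eqF// ler_expR ler_pM2r// ln_gt0.
Qed.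

Lemma absvD x y : abs (x + y) <= Num.max (abs x) (abs y).
Proof.
have [vNy _ _ vD] := v_val; have := vD x y.
case Ex : (v x) (vNy x) => [r| |]// _; case Ey : (v y) (vNy y) => [s| |]// _.
- rewrite (absv_fin Ex) (absv_fin Ey) le_max !absv_leP.
  by rewrite ge_min => /orP[->|->]; rewrite ?orbT.
- by rewrite min_l ?leey// => h; rewrite (absv_fin Ex) le_max absv_leP h.
- by rewrite min_r ?leey// => h; rewrite (absv_fin Ey) le_max !absv_leP h orbT.
- by rewrite minxx leye_eq => /eqP h; rewrite {1}/absv h le_max absv_ge0.
Qed.

Lemma absv_trans x y z : abs (x - z) <= Num.max (abs (x - y)) (abs (y - z)).
Proof. by have := absvD (x - y) (y - z); rewrite addrA subrK. Qed.

Lemma absv_trans_le (m : R) y x z :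
  abs (x - y) <= m -> abs (y - z) <= m -> abs (x - z) <= m.
Proof. by move=> h1 h2; rewrite (le_trans (absv_trans x y z))// ge_max h1. Qed.

Lemma absv_dense : (forall al be : R, al < be ->
    exists x ga, [/\ v x = ga%:E, al <= ga & ga < be]) ->
  forall r s, 0 <= r -> r < s -> exists x, r < abs x <= s.
Proof.
move=> dens r s r0 rs; have s0 : 0 < s by apply: le_lt_trans rs.
have lnb : 0 < ln b by rewrite ln_gt0.
(* As [r] may be 0 and have no logarithm, it is replaced by a positive [t] with [r <= t < s]. *)
pose t := Num.max r (s / 2).
have t0 : 0 < t by rewrite lt_max divr_gt0 ?orbT.
have ts : t < s by rewrite gt_max rs; lra.
have [|x [ga [vx al be]]] := dens (- (ln s / ln b)) (- (ln t / ln b)).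
  by rewrite ltrN2 ltr_pM2r ?invr_gt0// ltr_ln.
exists x; rewrite (absv_fin vx) /powR gt_eqF//.
rewrite -ler_ln ?posrE ?expR_gt0// expRK -ler_pdivlMr// lerNl al andbT.
apply: (@le_lt_trans _ _ t); first by rewrite le_max lexx.
by rewrite -ltr_ln ?posrE ?expR_gt0// expRK -ltr_pdivrMr// ltrNr.
Qed.

End ValuedField.

(** An element of valuation [de > 0] has an [n]-th root in the algebraically closed field [L], of
    valuation [de / n]. Once this is less than [be - al], one of its integer multiples lies between
    [al] and [be]. *)
Lemma value_group_dense (R : realType) (b : R) (K Khat : fieldType)
    (vK : K -> \bar R) (vhat : Khat -> \bar R) (phi : {rmorphism K -> Khat}) :
    is_valuation vK -> nontrivial_valuation vK ->
    completed_algebraic_closure b vK vhat phi ->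
  forall al be : R, al < be ->
    exists x ga, [/\ vhat x = ga%:E, al <= ga & ga < be].
Proof.
move=> vK_val [x0 x0N vx0] [vhat_val vphi _ [L [f [g [fg _ _]]]]] al be ab.
have [x [de [de0 vx]]] : exists x de, 0 < de /\ vK x = de%:E.
  have [r Er] := valuation_fin_num vK_val x0N.
  have [r0|r0|r0] := ltgtP 0 r.
  - by exists x0, r.
  - by exists x0^-1, (- r); rewrite oppr_gt0 (valuationV vK_val Er).
  - by move: vx0; rewrite Er -r0 eqxx.
pose n := (Num.trunc (de / (be - al))).+1.
have n0 : (0 : R) < n%:R by rewrite ltr0n.
have den : de / n%:R < be - al.
  rewrite ltr_pdivrMr// mulrC -ltr_pdivrMr ?subr_gt0//.
  by rewrite /n truncnS_gt.
(* The function lists the lower coefficients on the right of the monic equation; only the constant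
   one is nonzero, so [y] is an [n]-th root of [f x]. *)
have [y yn] := @solve_monicpoly L n (fun i => if i == 0%N then f x else 0) isT.
have {}yn : y ^+ n = f x.
  rewrite yn (bigD1 ord0)//= expr0 mulr1 big1 ?addr0// => i i0.
  by rewrite ifF ?mul0r//; apply: negbTE; apply: contra i0 => /eqP h; apply/eqP/val_inj.
have vy : vhat (g y ^+ n) = de%:E by rewrite -rmorphXn yn fg vphi.
have [r Er] : exists r, vhat (g y) = r%:E.
  apply: (valuation_fin_num vhat_val); apply/eqP => gy0.
  by move: vy; rewrite gy0 expr0n /= valuation0.
have rE : r = de / n%:R.
  have := valuationX vhat_val n Er; rewrite vy => -[->].
  by rewrite -[r *+ n]mulr_natr mulfK// gt_eqF.
have r0 : 0 < r by rewrite rE divr_gt0.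
(* The least multiple of [r] that is at least [al] is less than [al + r], hence less than [be]. *)
exists (g y ^ Num.ceil (al / r)), ((Num.ceil (al / r))%:~R * r); split.
- exact: valuationXz.
- by rewrite -ler_pdivrMr// ceil_ge.
- rewrite -rE in den.
  by have := ceilB1_lt (al / r); rewrite ltr_pdivlMr// intrB; lra.
Qed.

(** * Discs *)

Section Discs.
Variables (R : realType) (b : R) (K Khat : fieldType).
Variables (vhat : Khat -> \bar R) (phi : {rmorphism K -> Khat}).
Hypotheses (b_gt1 : 1 < b) (vhat_val : is_valuation vhat).
Hypothesis dense : forall r s : R, 0 <= r -> r < s ->
  exists z, r < absv b vhat z <= s.

Local Notation abs := (absv b vhat).
Local Notation disc := (discB b vhat phi).
Local Notation D a a' := (abs (phi (a - a'))).

Let DC a a' : D a a' = D a' a.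
Proof. by rewrite !rmorphB (absvC b vhat_val). Qed.

Let D_trans m y x z : D x y <= m -> D y z <= m -> D x z <= m.
Proof. by rewrite !rmorphB; apply: absv_trans_le. Qed.

Let abs0 : abs 0 = 0. Proof. exact: absv0. Qed.

Lemma disc_center a r : 0 <= r -> disc a r (phi a).
Proof. by move=> r0; rewrite /discB /= subrr abs0. Qed.

(** If [r' < r], density gives [z] with [r' < |z| <= r]. An inclusion would put [phi a] and
    [phi a + z] in the second disc, whose points are at mutual distance at most [r']. *)
Lemma disc_subset a r a' r' : 0 <= r -> 0 <= r' ->
  disc a r `<=` disc a' r' <-> D a a' <= r' /\ r <= r'.
Proof.
move=> r0 r0'; split=> [S|[Da rr] z]; last first.
  rewrite /discB /= => az; apply: (absv_trans_le b_gt1 vhat_val (y := phi a)).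
    by rewrite -rmorphB DC.
  exact: le_trans rr.
have Da : D a a' <= r' by rewrite DC rmorphB; apply: S; apply: disc_center.
split=> //; rewrite leNgt; apply/negP => rr.
have [z /andP[z1 z2]] := dense r0' rr.
have : disc a' r' (phi a + z).
  by apply: S; rewrite /discB /= opprD addNKr absvN.
rewrite /discB /= => h; move: z1; rewrite ltNge => /negP; apply.
have -> : z = (phi a + z) - phi a by ring.
apply: (absv_trans_le b_gt1 vhat_val (y := phi a')); first by rewrite (absvC b vhat_val).
by rewrite -rmorphB DC.
Qed.

Lemma disc_eq a r a' r' : 0 <= r -> 0 <= r' ->
  disc a r = disc a' r' <-> D a a' <= r /\ r = r'.
Proof.
move=> r0 r0'; split=> [E|[Da <-]].
  have [h1 h2] : D a a' <= r' /\ r <= r' by apply/disc_subset => //; rewrite E.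
  have [h3 h4] : D a' a <= r /\ r' <= r by apply/disc_subset => //; rewrite E.
  by split; [rewrite DC|apply/le_anti; rewrite h2].
by apply/seteqP; split; apply/disc_subset => //; rewrite DC.
Qed.

Lemma centerB_disc a r : 0 <= r -> disc (centerB b vhat phi (disc a r)) r = disc a r.
Proof.
move=> r0; have [|s [s0 E]] := xgetPex 0 (P := [set c | exists s, 0 <= s /\ disc a r = disc c s]).
  by exists a, r.
rewrite /centerB; set c := xget _ _ in E *.
by have [_ rs] := (disc_eq _ _ r0 s0).1 E; rewrite rs -E -rs.
Qed.

Lemma radiusB_disc a r : 0 <= r -> radiusB b vhat phi (disc a r) = r.
Proof.
move=> r0; apply: xget_unique; first by split=> //; exists a.
by move=> s [s0 [c /(disc_eq _ _ r0 s0)[_ ->]]].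
Qed.

(** One formula covers nested and disjoint discs. In the disjoint case the chosen centres differ
    from [a] and [a'] by at most [Num.max r r'], which is less than [D a a'], so by the ultrametric
    inequality they are at the same distance as [a] and [a']. *)
Lemma joinB_disc a r a' r' : 0 <= r -> 0 <= r' ->
  joinB b vhat phi (disc a r) (disc a' r') =
  disc a (Num.max (Num.max r r') (D a a')).
Proof.
move=> r0 r0'; rewrite /joinB; case: asboolP => [[S|S]|N].
- have /(disc_subset _ _ r0 r0')[Da rr] := S.
  rewrite ((setUidPr _ _).2 S) (max_r rr) (max_l Da).
  by apply/disc_eq => //; rewrite DC.
- have /(disc_subset _ _ r0' r0)[Da rr] := S.
  by rewrite ((setUidPl _ _).2 S) (max_l rr) max_l// DC.
have mD : Num.max r r' < D a a'.
  rewrite ltNge; apply/negP; rewrite le_max => h; apply: N; rewrite /nested.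
  have [rr|rr] := leP r r'; [left|right]; apply/disc_subset => //.
    by split=> //; case/orP: h => // /le_trans; apply.
  rewrite DC; split; last exact: ltW.
  by case/orP: h => // /le_trans; apply; apply: ltW.
have [rD r'D] : r <= D a a' /\ r' <= D a a'.
  by move: mD; rewrite gt_max => /andP[/ltW ? /ltW].
rewrite (max_r (ltW mD)).
set c := centerB _ _ _ (disc a r); set c' := centerB _ _ _ (disc a' r').
have [Dc _] := (disc_eq _ _ r0 r0).1 (centerB_disc a r0).
have [Dc' _] := (disc_eq _ _ r0' r0').1 (centerB_disc a' r0').
rewrite -/c -/c' in Dc Dc'.
have cc' : D c c' <= D a a'.
  apply: (D_trans (y := a)); first exact: le_trans rD.
  by apply: (D_trans (y := a')) => //; rewrite DC (le_trans Dc').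
have E : D c c' = D a a'.
  apply/le_anti; rewrite cc' /= leNgt; apply/negP => lt.
  have : D a a' <= Num.max (Num.max r r') (D c c').
    apply: (D_trans (y := c)); first by rewrite DC !le_max Dc.
    by apply: (D_trans (y := c')); rewrite !le_max ?lexx ?Dc' ?orbT.
  by apply/negP; rewrite -ltNge gt_max mD.
rewrite E; apply/disc_eq; rewrite ?(le_trans r0 rD)//.
by split=> //; exact: le_trans rD.
Qed.

Lemma polydiscs_products n (P : R -> Prop) :
  [set B | exists (a : 'rV[K]_n) (r : 'rV[R]_n),
     (forall i, P (r 0 i)) /\ B = polydiscB b vhat phi a r] =
  products [set B | exists a r, P r /\ B = disc a r] n.
Proof.
apply/seteqP; split=> [_ [a [r [Pr ->]]]|_ [B XB ->]].
  by exists (fun i => disc (a 0 i) (r 0 i)) => // i; exists (a 0 i), (r 0 i).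
have /choice[a /choice[r H]] := XB.
exists (\row_i a i), (\row_i r i); split=> [i|].
  by rewrite mxE; case: (H i).
by congr prod_set; apply/funext => i; rewrite !mxE; case: (H i).
Qed.

(* Discs of radius [e h], where [h] is a height coordinate: [e] is the
   identity for the metric [distB] and [h |-> b ^ h] for the metric [distH]. *)
Section Heights.
Variables (dom : R -> Prop) (e ell : R -> R) (rad : set Khat -> R).
Hypothesis dom_le : forall h k, dom h -> h <= k -> dom k.
Hypothesis e_ge0 : forall h, dom h -> 0 <= e h.
Hypothesis e_le : forall h k, dom h -> dom k -> (e h <= e k) = (h <= k).
(** An inverse of [e] is required only above some [e h], because for the logarithmic height the
    radius 0 has no height. *)
Hypothesis ellK : forall h r, dom h -> e h <= r -> dom (ell r) /\ e (ell r) = r.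
Hypothesis rad_disc : forall a h, dom h -> rad (disc a (e h)) = h.

Definition height_discs : set (set Khat) :=
  [set B | exists a h, dom h /\ B = disc a (e h)].

Definition height_up (B : set Khat) h := disc (centerB b vhat phi B) (e h).

Definition height_top (B B' : set Khat) := rad (joinB b vhat phi B B').

(** Has the shape of [distB] and [distH]; for the latter [rad] is minus [radiusH], a sign that the
    absolute values absorb. *)
Definition height_dist (B B' : set Khat) :=
  if `[< nested B B' >] then `|rad B - rad B'|
  else `|rad B - rad (joinB b vhat phi B B')|
       + `|rad (joinB b vhat phi B B') - rad B'|.

Lemma height_up_disc a h k : dom h -> h <= k ->
  height_up (disc a (e h)) k = disc a (e k).
Proof.
move=> dh hk; have dk := dom_le dh hk.
have [Dc _] := (disc_eq _ _ (e_ge0 dh) (e_ge0 dh)).1 (centerB_disc a (e_ge0 dh)).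
apply/disc_eq; [exact: e_ge0|exact: e_ge0|split=> //].
by apply: le_trans Dc _; rewrite e_le.
Qed.

(** The radius of the join is at least [e h], so it is again the radius of some height. *)
Lemma height_joinE a h a' h' : dom h -> dom h' ->
  exists k, [/\ h <= k, h' <= k, dom k,
    e k = Num.max (Num.max (e h) (e h')) (D a a') &
    joinB b vhat phi (disc a (e h)) (disc a' (e h')) = disc a (e k)].
Proof.
move=> dh dh'; set M := Num.max _ _.
have hM : e h <= M by rewrite !le_max lexx.
have hM' : e h' <= M by rewrite !le_max lexx orbT.
have [dk ek] := ellK dh hM; exists (ell M).
by rewrite -(e_le dh dk) -(e_le dh' dk) ek; split=> //; rewrite joinB_disc// e_ge0.
Qed.

Lemma height_tree : merging_tree height_discs rad height_up height_top.
Proof.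
split.
- move=> _ h [a [k [dk ->]]]; rewrite rad_disc// => kh.
  by rewrite height_up_disc//; exists a, h; split=> //; apply: dom_le kh.
- move=> _ h [a [k [dk ->]]]; rewrite rad_disc// => kh.
  by rewrite height_up_disc// rad_disc//; apply: dom_le kh.
- by move=> _ [a [k [dk ->]]]; rewrite rad_disc// height_up_disc.
- move=> _ h k [a [l [dl ->]]]; rewrite rad_disc// => lh hk.
  have dh := dom_le dl lh.
  by rewrite !height_up_disc//; apply: le_trans hk.
- move=> _ _ [a [h [dh ->]]] [a' [h' [dh' ->]]]; rewrite rad_disc// /height_top.
  by have [k [hk _ dk _ ->]] := height_joinE a a' dh dh'; rewrite rad_disc.
- move=> _ _ [a [h [dh ->]]] [a' [h' [dh' ->]]]; rewrite /height_top; congr rad.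
  rewrite !joinB_disc ?e_ge0// DC (maxC (e h')).
  have M0 : 0 <= Num.max (Num.max (e h) (e h')) (D a' a).
    by rewrite !le_max e_ge0.
  by apply/disc_eq => //; rewrite DC le_max lexx orbT.
- move=> _ _ g [a [h [dh ->]]] [a' [h' [dh' ->]]]; rewrite !rad_disc// => hg hg'.
  have dg := dom_le dh hg; have g0 := e_ge0 dg.
  rewrite !height_up_disc// /height_top.
  have [k [hk _ dk ek ->]] := height_joinE a a' dh dh'; rewrite rad_disc//.
  (* Since [g] bounds both heights, [k <= g] reduces to [D a a' <= e g], the condition for the two
     discs of height [g] to coincide. *)
  rewrite -(e_le dk dg) ek !ge_max !e_le// hg hg' /=.
  by split=> [/(disc_eq _ _ g0 g0)[]//|Da]; apply/disc_eq.
Qed.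

Lemma height_distE B B' : height_discs B -> height_discs B' ->
  height_dist B B' = 2 * height_top B B' - rad B - rad B'.
Proof.
move=> [a [h [dh ->]]] [a' [h' [dh' ->]]]; rewrite /height_dist /height_top.
have [k [hk hk' dk ek ->]] := height_joinE a a' dh dh'; rewrite !rad_disc//.
have h0 := e_ge0 dh; have h0' := e_ge0 dh'.
case: asboolP => [[S|S]|_].
- have [Da] := (disc_subset _ _ h0 h0').1 S; rewrite e_le// => hh.
  have kh : k <= h' by rewrite -(e_le dk dh') ek !ge_max Da lexx !e_le// hh.
  by rewrite distrC ger0_norm ?subr_ge0//; lra.
- have [Da] := (disc_subset _ _ h0' h0).1 S; rewrite e_le// => hh.
  have kh : k <= h by rewrite -(e_le dk dh) ek !ge_max DC Da lexx !e_le// hh.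
  by rewrite ger0_norm ?subr_ge0//; lra.
- by rewrite distrC !ger0_norm ?subr_ge0//; lra.
Qed.

Lemma height_join_up B B' : height_discs B -> height_discs B' ->
  joinB b vhat phi B B' = height_up B (height_top B B').
Proof.
move=> [a [h [dh ->]]] [a' [h' [dh' ->]]]; rewrite /height_top.
have [k [hk hk' dk ek ->]] := height_joinE a a' dh dh'.
by rewrite rad_disc// height_up_disc.
Qed.

Lemma height_discs_neq0 B : height_discs B -> B !=set0.
Proof.
by move=> [a [h [dh ->]]]; exists (phi a); apply: disc_center; apply: e_ge0.
Qed.

Local Notation path := (tree_path rad height_up height_top height_dist).

Definition height_gamma a h a' h' t : set Khat :=
  let B := disc a (e h) in
  let B' := disc a' (e h') in
  let r := height_dist B B' in
  let r1 := height_dist B (joinB b vhat phi B B') in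
  if `[< B = B' >] then B
  else if t <= r1 / r then disc a (e (h + r * t))
  else disc a' (e (h' + r * (1 - t))).

Section TwoDiscs.
Variables (a a' : K) (h h' : R).
Hypotheses (dh : dom h) (dh' : dom h').
Let B := disc a (e h).
Let B' := disc a' (e h').

Let XB : height_discs B. Proof. by exists a, h. Qed.
Let XB' : height_discs B'. Proof. by exists a', h'. Qed.

(** For [t] in this interval both target heights are at least those of the given discs, so
    [height_up] may be computed with the given centres. *)
Lemma height_gammaE : {in `[0, 1], path B B' =1 height_gamma a h a' h'}.
Proof.
move=> t; rewrite in_itv /= => /andP[t0 t1].
rewrite /tree_path /height_gamma -/B -/B' -height_join_up// !rad_disc//.
have [d0 _ _ _] := tree_metric height_tree height_distE.
have {}d0 := d0 _ _ XB XB'.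
by rewrite !height_up_disc// lerDl mulr_ge0// subr_ge0.
Qed.

Lemma height_disc_geodesic : B <> B' ->
  let J := joinB b vhat phi B B' in
  let r := height_dist B B' in
  let r1 := height_dist B J in
  let r2 := height_dist B' J in
  let gamma := height_gamma a h a' h' in
  [/\ r = r1 + r2,
      h + r1 = h' + r2,
      forall t, t \in `[0, 1] -> t <= r1 / r -> gamma t = disc a (e (h + r * t)),
      forall t, t \in `[0, 1] -> r1 / r <= t ->
        gamma t = disc a' (e (h' + r * (1 - t)))
    & exists lam, geodesic_from_to height_discs height_dist lam B B' 0 1 gamma].
Proof.
move=> BB' J r r1 r2 gamma; have JE := height_join_up XB XB'.
have [d0 _ _ _] := tree_metric height_tree height_distE.
have {}d0 : 0 <= r := d0 _ _ XB XB'.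
have [E1 E2] := tree_dist_split height_tree height_distE XB XB'.
split.
- by rewrite /r1 /r2 /J JE.
- by move: E2; rewrite !rad_disc// -JE.
- move=> t It tr; rewrite /gamma -height_gammaE// tree_path_left// -?JE// rad_disc//.
  move: It; rewrite in_itv /= => /andP[t0 t1].
  by rewrite height_up_disc// lerDl mulr_ge0.
- move=> t It tr; rewrite /gamma -height_gammaE//.
  rewrite (tree_path_right height_tree height_distE)// -?JE// rad_disc//.
  move: It; rewrite in_itv /= => /andP[t0 t1].
  by rewrite height_up_disc// lerDl mulr_ge0// subr_ge0.
- exists r; apply: (geodesic_from_to_eq height_gammaE).
  exact: (tree_path_geodesic height_tree height_distE).
Qed.

End TwoDiscs.

Lemma height_polydisc_geodesic n (p : \bar R) (a a' : 'I_n -> K) (h h' : 'I_n -> R) :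
    (1 <= p)%E -> (forall i, dom (h i)) -> (forall i, dom (h' i)) ->
  let B := prod_set (fun i => disc (a i) (e (h i))) in
  let B' := prod_set (fun i => disc (a' i) (e (h' i))) in
  B <> B' ->
  exists lam, geodesic_from_to (products height_discs n)
    (lp_dist height_dist p (n := n)) lam B B' 0 1
    (fun t => prod_set (fun i => height_gamma (a i) (h i) (a' i) (h' i) t)).
Proof.
move=> p1 dh dh' B B' BB'; exists (lp_dist height_dist p B B').
have XB i : height_discs (disc (a i) (e (h i))) by exists (a i), (h i).
have XB' i : height_discs (disc (a' i) (e (h' i))) by exists (a' i), (h' i).
pose g i := path (disc (a i) (e (h i))) (disc (a' i) (e (h' i))).
apply: (@geodesic_from_to_eq _ _ _ _ _ _ _ _ _ (fun t => prod_set (g ^~ t))).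
  by move=> t It; congr prod_set; apply/funext => i; apply: height_gammaE.
apply: prod_geodesic => //.
- exact: height_discs_neq0.
- exact: (tree_metric height_tree height_distE).
- by move=> i t; apply: (tree_path_in height_tree height_distE).
- by move=> i t t'; apply: (tree_path_dist height_tree height_distE).
- by move=> i; apply: (tree_path0 height_tree height_distE).
- by move=> i; apply: (tree_path1 height_tree height_distE).
Qed.

Lemma height_polydisc_spaces n (p : \bar R) : (1 <= p)%E ->
  let X := products height_discs n in
  let d := lp_dist height_dist p (n := n) in
  geodesic_space X d /\
  (n = 1%N \/ (1 < p < +oo)%E -> uniquely_geodesic_space X d).
Proof.
move=> p1 X d; have dm := tree_metric height_tree height_distE.
have geo : geodesic_space X d.
  apply: geodesic_space_of_paths.
    exact: (lp_dist_metric n height_discs_neq0 dm p1).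
  move=> _ _ [B XB ->] [B' XB' ->] BB'.
  exists (lp_dist height_dist p (prod_set B) (prod_set B')).
  exists (fun t => prod_set (fun i => path (B i) (B' i) t)).
  apply: (prod_geodesic height_discs_neq0 dm p1 XB XB' BB').
  - by move=> i t; apply: (tree_path_in height_tree height_distE).
  - by move=> i t t'; apply: (tree_path_dist height_tree height_distE).
  - by move=> i; apply: (tree_path0 height_tree height_distE).
  - by move=> i; apply: (tree_path1 height_tree height_distE).
split=> // np; apply: uniquely_geodesic_of_between => //.
apply: (prod_unique_between height_discs_neq0 dm p1) np.
exact: (tree_unique_between height_tree height_distE).
Qed.

End Heights.
End Discs.

(** * The logarithm of the radius as height *)

Section LogarithmicRadius.
Variables (R : realType) (b : R) (K Khat : fieldType).
Variables (vhat : Khat -> \bar R) (phi : {rmorphism K -> Khat}).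
Hypotheses (b_gt1 : 1 < b) (vhat_val : is_valuation vhat).
Hypothesis dense : forall r s : R, 0 <= r -> r < s ->
  exists z, r < absv b vhat z <= s.

Let b_gt0 : 0 < b. Proof. exact: lt_trans b_gt1. Qed.

Let ln_b_gt0 : 0 < ln b. Proof. by rewrite ln_gt0. Qed.

Lemma powR_log r : 0 < r -> b `^ (ln r / ln b) = r.
Proof. by move=> r0; rewrite /powR gt_eqF// divfK ?gt_eqF// lnK. Qed.

Lemma powR_le_mono x y : (b `^ x <= b `^ y) = (x <= y).
Proof. by rewrite /powR gt_eqF// ler_expR ler_pM2r. Qed.

Lemma discH_discB a v : discH vhat phi a v%:E = discB b vhat phi a (b `^ (- v)).
Proof.
by apply/seteqP; split=> z; rewrite /discH /discB /= (absv_leP b_gt1 vhat_val).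
Qed.

(** The sign makes larger discs higher, as the tree structure demands. *)
Lemma radiusH_disc a h : - radiusH vhat phi (discB b vhat phi a (b `^ h)) = h.
Proof.
rewrite (_ : radiusH _ _ _ = - h) ?opprK//; apply: xget_unique.
  by exists a; rewrite discH_discB opprK.
move=> v [c]; rewrite discH_discB => E.
have [_ /eqP] := (disc_eq phi b_gt1 vhat_val dense _ _ (powR_ge0 _ _) (powR_ge0 _ _)).1 E.
by rewrite eq_le !powR_le_mono -eq_le => /eqP ->; rewrite opprK.
Qed.

Lemma discsHE : discsH b vhat phi =
  height_discs b vhat phi (fun=> True) (fun h => b `^ h).
Proof.
apply/seteqP; split=> [_ [a [r [r0 ->]]]|_ [a [h [_ ->]]]].
  by exists a, (ln r / ln b); rewrite powR_log.
by exists a, (b `^ h); rewrite powR_gt0.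
Qed.

Lemma distHE : distH b vhat phi =
  height_dist b vhat phi (fun B => - radiusH vhat phi B).
Proof.
apply/funext => B; apply/funext => B'; rewrite /distH /height_dist.
by rewrite -!opprD !normrN.
Qed.

Lemma gammaHE a v a' v' : gammaH b vhat phi a v a' v' =
  height_gamma b vhat phi (fun h => b `^ h) (fun B => - radiusH vhat phi B)
    a (- v) a' (- v').
Proof.
apply/funext => t; rewrite /gammaH /height_gamma -distHE !discH_discB.
by rewrite !opprB ![_ - v]addrC ![_ - v']addrC.
Qed.

End LogarithmicRadius.

(** * Both metrics as instances of the height construction *)

Theorem lemma12 (R : realType) (b : R) (K Khat : fieldType)
    (vK : K -> \bar R) (vhat : Khat -> \bar R) (phi : {rmorphism K -> Khat})
    (b_gt1 : 1 < b)
    (vK_val : is_valuation vK)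
    (vK_nontrivial : nontrivial_valuation vK)
    (vK_complete : complete_valued b vK)
    (Khat_closure : completed_algebraic_closure b vK vhat phi) :
  (* (i) *)
  ((forall (a a' : K) (s s' : R), 0 <= s -> 0 <= s' ->
      let B := discB b vhat phi a s in
      let B' := discB b vhat phi a' s' in
      B <> B' ->
      let J := joinB b vhat phi B B' in
      let r := distB b vhat phi B B' in
      let r1 := distB b vhat phi B J in
      let r2 := distB b vhat phi B' J in
      let gamma := gammaB b vhat phi a s a' s' in
      [/\ r = r1 + r2,
          s + r1 = s' + r2,
          forall t, t \in `[0, 1] -> t <= r1 / r ->
            gamma t = discB b vhat phi a (s + r * t),
          forall t, t \in `[0, 1] -> r1 / r <= t ->
            gamma t = discB b vhat phi a' (s' + r * (1 - t))
        & exists lam, geodesic_from_to (discsB b vhat phi) (distB b vhat phi)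
            lam B B' 0 1 gamma]) /\
   (forall (n : nat) (p : \bar R), (1 <= n)%N -> (1 <= p)%E ->
      forall (a a' : 'rV[K]_n) (s s' : 'rV[R]_n),
      (forall i, 0 <= s 0 i) -> (forall i, 0 <= s' 0 i) ->
      let B := polydiscB b vhat phi a s in
      let B' := polydiscB b vhat phi a' s' in
      B <> B' ->
      exists lam, geodesic_from_to (@polydiscsB R b K Khat vhat phi n)
        (@distBp R b K Khat vhat phi p n) lam B B' 0 1
        (fun t => prod_set (fun i =>
           gammaB b vhat phi (a 0 i) (s 0 i) (a' 0 i) (s' 0 i) t)))) /\
  (* (ii) *)
  ((forall (a a' : K) (v v' : R),
      let B := discH vhat phi a v%:E in
      let B' := discH vhat phi a' v'%:E in
      B <> B' ->
      let J := joinB b vhat phi B B' in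
      let w := distH b vhat phi B B' in
      let w1 := distH b vhat phi B J in
      let w2 := distH b vhat phi B' J in
      let gamma := gammaH b vhat phi a v a' v' in
      [/\ w = w1 + w2,
          v - w1 = v' - w2,
          forall t, t \in `[0, 1] -> t <= w1 / w ->
            gamma t = discH vhat phi a (v - w * t)%:E,
          forall t, t \in `[0, 1] -> w1 / w <= t ->
            gamma t = discH vhat phi a' (v' - w * (1 - t))%:E
        & exists lam, geodesic_from_to (discsH b vhat phi) (distH b vhat phi)
            lam B B' 0 1 gamma]) /\
   (forall (n : nat) (p : \bar R), (1 <= n)%N -> (1 <= p)%E ->
      forall (a a' : 'rV[K]_n) (v v' : 'rV[R]_n),
      let B := polydiscH vhat phi a (map_mx EFin v) in
      let B' := polydiscH vhat phi a' (map_mx EFin v') in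
      B <> B' ->
      exists lam, geodesic_from_to (@polydiscsH R b K Khat vhat phi n)
        (@distHp R b K Khat vhat phi p n) lam B B' 0 1
        (fun t => prod_set (fun i =>
           gammaH b vhat phi (a 0 i) (v 0 i) (a' 0 i) (v' 0 i) t)))) /\
  (* (iii) *)
  (forall (n : nat) (p : \bar R), (1 <= n)%N -> (1 <= p)%E ->
     let Bn := @polydiscsB R b K Khat vhat phi n in
     let Hn := @polydiscsH R b K Khat vhat phi n in
     let dB := @distBp R b K Khat vhat phi p n in
     let dH := @distHp R b K Khat vhat phi p n in
     [/\ geodesic_space Bn dB,
         geodesic_space Hn dH
       & n = 1%N \/ (1 < p < +oo)%E ->
         uniquely_geodesic_space Bn dB /\ uniquely_geodesic_space Hn dH]).
Proof.
have opp_eq (x y z t : R) : - x + y = - z + t -> x - y = z - t by lra.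
have [vhat_val _ _ _] := Khat_closure.
have dense := absv_dense b_gt1
  (value_group_dense vK_val vK_nontrivial Khat_closure).
(* For the first metric heights are radii, and [eB] serves as its own inverse. *)
pose domB (h : R) : Prop := 0 <= h.
pose eB (h : R) := h.
have domB_le h k : domB h -> h <= k -> domB k by exact: le_trans.
have eB_ge0 h : domB h -> 0 <= eB h by [].
have eB_le h k : domB h -> domB k -> (eB h <= eB k) = (h <= k) by [].
have eBK h r : domB h -> eB h <= r -> domB (eB r) /\ eB (eB r) = r.
  by move=> h0 hr; split=> //; apply: le_trans hr.
have radB a h : domB h -> radiusB b vhat phi (discB b vhat phi a (eB h)) = h.
  exact: radiusB_disc.
(* For the second metric heights are logarithms of radii to base [b], and every real number
   occurs. *)
pose domH (h : R) := True.
pose eH (h : R) := b `^ h.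
have domH_le h k : domH h -> h <= k -> domH k by [].
have eH_ge0 h : domH h -> 0 <= eH h by move=> _; exact: powR_ge0.
have eH_le h k : domH h -> domH k -> (eH h <= eH k) = (h <= k).
  by move=> _ _; exact: powR_le_mono.
have eHK h r : domH h -> eH h <= r -> domH (ln r / ln b) /\ eH (ln r / ln b) = r.
  move=> _ hr; split=> //; apply: (powR_log b_gt1); apply: lt_le_trans hr.
  exact: powR_gt0 (lt_trans ltr01 b_gt1).
pose rH (B : set Khat) := - radiusH vhat phi B.
have radH a h : domH h -> rH (discB b vhat phi a (eH h)) = h.
  by move=> _; exact: radiusH_disc.
have polyB n : polydiscsB b vhat phi (n := n) = products (height_discs b vhat phi domB eB) n.
  exact: polydiscs_products.
have polyH n : polydiscsH b vhat phi (n := n) = products (height_discs b vhat phi domH eH) n.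
  by rewrite -discsHE//; exact: polydiscs_products.
have HB := discH_discB phi b_gt1 vhat_val.
have gHE := gammaHE phi b_gt1 vhat_val.
have dHE := discsHE vhat phi b_gt1.
split; [split|split; [split|]].
- move=> a a' s s' s0 s0' B B' BB'.
  exact: (height_disc_geodesic b_gt1 vhat_val dense domB_le eB_ge0 eB_le eBK radB s0 s0' BB').
- move=> n p _ p1 a a' s s' s0 s0' B B' BB'; rewrite polyB.
  exact: (height_polydisc_geodesic b_gt1 vhat_val dense domB_le eB_ge0 eB_le eBK radB p1 s0 s0' BB').
(* In terms of heights the discs have heights [- v] and [- v']; the signs are undone afterwards. *)
- move=> a a' v v'; rewrite distHE gHE dHE !HB => B B' BB' J w w1 w2 gamma.
  have [E1 E2 E3 E4 E5] := height_disc_geodesic b_gt1 vhat_val dense domH_le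
    eH_ge0 eH_le eHK radH (I : domH (- v)) (I : domH (- v')) BB'.
  split.
  + exact: E1.
  + exact: opp_eq E2.
  + by move=> t It tw; rewrite HB opprB addrC; exact: E3.
  + by move=> t It tw; rewrite HB opprB addrC; exact: E4.
  + exact: E5.
- move=> n p _ p1 a a' v v' B B'; rewrite polyH /distHp distHE.
  have BE (c : 'rV[K]_n) (u : 'rV[R]_n) : polydiscH vhat phi c (map_mx EFin u) =
      prod_set (fun i => discB b vhat phi (c 0 i) (eH (- u 0 i))).
    by congr prod_set; apply/funext => i; rewrite mxE HB.
  rewrite /B /B' !BE => BB'.
  have [lam H] := height_polydisc_geodesic b_gt1 vhat_val dense domH_le eH_ge0
    eH_le eHK radH p1 (fun=> I) (fun=> I) BB'.
  exists lam; apply: geodesic_from_to_eq H => t _.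
  by congr prod_set; apply/funext => i; rewrite gHE.
- move=> n p _ p1; rewrite polyB polyH /distHp distHE.
  have [h1 h2] := height_polydisc_spaces b_gt1 vhat_val dense domB_le eB_ge0
    eB_le eBK radB n p1.
  have [h3 h4] := height_polydisc_spaces b_gt1 vhat_val dense domH_le eH_ge0
    eH_le eHK radH n p1.
  split; [exact: h1|exact: h3|] => np.
by split; [exact: h2|exact: h4].
Qed.
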